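(* Take any integer $d\ge 2$. Let $L_n$ be the length of the optimal tour in the stochastic traveling salesman problem with $n$ points when the points are distributed independently and uniformly in $[0,1]^d$. Then $L_n$ has fluctuations of order at least $n^{(d-2)/(2d)}$.
   Context: Fluctuations: for a sequence of random variables $\{X_n\}$ and a sequence of positive real numbers $\{\delta_n\}$, we say that $X_n$ has fluctuations of order at least $\delta_n$ if there are positive constants $c_1,c_2$ such that for all large $n$, and for all $-\infty<a\le b<\infty$ with $b-a\le c_1\delta_n$, $\mathbb{P}(a\le X_n\le b)\le 1-c_2$. The length of the optimal tour through points $x_1,\ldots,x_n\in\mathbb{R}^d$ is the minimum over permutations $\pi$ of $\{1,\ldots,n\}$ of $\sum_{i=1}^{n}\|x_{\pi(i)}-x_{\pi(i+1)}\|$, with $\pi(n+1):=\pi(1)$ and $\|\cdot\|$ the Euclidean norm. *)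

(* Defs.v *)
From HB Require Import structures.
From mathcomp Require Import all_boot all_order all_algebra all_fingroup.
From mathcomp Require Import all_classical all_reals all_analysis.
From mathcomp Require Import measurable_realfun.

Set Implicit Arguments.
Unset Strict Implicit.
Unset Printing Implicit Defensive.

Import Order.TTheory GRing.Theory Num.Theory.
Import numFieldNormedType.Exports.

Local Open Scope classical_set_scope.
Local Open Scope ring_scope.

(* R^d is d.-tuple R with the product of the Borel sigma-algebras. *)

(* The d-fold iterated product of the Lebesgue measure on R. *)
Fixpoint tuple_lebesgue (R : realType) (d : nat) : set (d.-tuple R) -> \bar R :=
  match d with
  | 0%N => dirac [tuple]
  | d'.+1 => pushforward
      ((@lebesgue_measure R) \x (@tuple_lebesgue R d'))%E
      (fun p : R * d'.-tuple R => [tuple of p.1 :: p.2])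
  end.

Definition unit_cube (R : realType) (d : nat) : set (d.-tuple R) :=
  [set x | forall k : 'I_d, 0 <= tnth x k <= 1].
Arguments unit_cube : clear implicits.

Section Points.
Context {disp : measure_display} {T : measurableType disp} {R : realType}.
Context (P : probability T R).

(* The cube has volume 1, so Lebesgue measure restricted to it needs no
   normalization. *)
Definition uniform_on_cube (d : nat) (X : {RV P >-> d.-tuple R}) : Prop :=
  forall A : set (d.-tuple R), measurable A ->
    distribution P X A = tuple_lebesgue (A `&` unit_cube R d).

Definition independent_RVs (I : finType) {disp' : measure_display}
    {T' : measurableType disp'} (X : I -> {RV P >-> T'}) : Prop :=
  forall (J : {set I}) (A : I -> set T'),
    (forall i, i \in J -> measurable (A i)) ->
    P (\bigcap_(i in [set` J]) (X i @^-1` A i)) =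
    (\prod_(i in J) P (X i @^-1` A i))%E.

End Points.

Definition euclidean_dist (R : realType) (d : nat) (x y : d.-tuple R) : R :=
  Num.sqrt (\sum_(k < d) (tnth x k - tnth y k) ^+ 2).

(* ordS is the cyclic successor, so the last city is followed by the first. *)
Definition tour_length (R : realType) (d n : nat) (x : 'I_n -> d.-tuple R)
    (s : 'S_n) : R :=
  \sum_(i < n) euclidean_dist (x (s i)) (x (s (ordS i))).

(* The base value of the iterated minimum is the tour of the identity
   permutation, which is one of the candidates. *)
Definition optimal_tour_length (R : realType) (d n : nat)
    (x : 'I_n -> d.-tuple R) : R :=
  \big[Num.min/tour_length x 1%g]_(s : 'S_n) tour_length x s.

Section OptimalTourRV.
Context {disp : measure_display} {T : measurableType disp} {R : realType}.
Context (P : probability T R) (d n : nat) (X : 'I_n -> {RV P >-> d.-tuple R}).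

Definition optimal_tour (w : T) : R := optimal_tour_length (fun i => X i w).

Lemma measurable_euclidean_dist (i j : 'I_n) :
  measurable_fun setT (fun w => euclidean_dist (X i w) (X j w)).
Proof.
have mX i0 (k : 'I_d) : measurable_fun setT (fun w => tnth (X i0 w) k).
  exact: (measurableT_comp (measurable_tnth k)).
apply: (measurableT_comp (continuous_measurable_fun (@sqrt_continuous R))).
apply: measurable_sum => k; apply: measurable_funX.
exact: measurable_funB.
Qed.

Lemma measurable_optimal_tour : measurable_fun setT optimal_tour.
Proof.
have mt (s : 'S_n) : measurable_fun setT (fun w => tour_length (fun i => X i w) s).
  by apply: measurable_sum => i; exact: measurable_euclidean_dist.
rewrite /optimal_tour /optimal_tour_length.
elim: (index_enum _) => [|s r IH].
  by under eq_fun do rewrite big_nil; exact: mt.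
under eq_fun do rewrite big_cons.
by apply: measurable_minr; [exact: mt|exact: IH].
Qed.

HB.instance Definition _ :=
  isMeasurableFun.Build _ _ _ _ optimal_tour measurable_optimal_tour.

Definition optimal_tour_RV : {RV P >-> R} := optimal_tour.

End OptimalTourRV.

(* Each X n may live on its own probability space: only the laws matter. *)
Definition fluctuations_at_least {R : realType} {disp : nat -> measure_display}
    {T : forall n, measurableType (disp n)}
    (P : forall n, probability (T n) R) (X : forall n, {RV (P n) >-> R})
    (delta : nat -> R) : Prop :=
  exists c1 c2 : R, [/\ 0 < c1, 0 < c2 &
    \forall n \near \oo, forall a b : R, a <= b -> b - a <= c1 * delta n ->
      (P n [set w | (a <= X n w <= b)%R] <= (1 - c2)%:E)%E].

(* Main.v *)
Require Import Defs.
From mathcomp Require Import all_boot all_order all_algebra all_fingroup.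
From mathcomp Require Import all_classical all_reals all_analysis.
From mathcomp Require Import measurable_realfun.
From mathcomp Require Import zify ring lra.

(** Idea of the proof. A bounded change of the shape of a small isolated cluster of
    points changes the length of the optimal tour by at least a constant times
    [n ^ (-1/d)], the typical distance between neighbours. Uniform points contain
    about [n] such clusters, whose shapes are independent given everything else,
    so the length fluctuates like [n ^ (1/2)] times [n ^ (-1/d)].

    Cut the cube into [q ^ d] blocks, of order [n], and each block into [B ^ d]
    cells. Given the position of every point within its own cell, the cells are
    independent and uniform, hence it is enough to bound, for all fixed offsets
    of the points, the proportion of the assignments of cells for which the
    optimal tour has a length in a short interval
    ([probability_le_cell_proportion]). Call a block good if it contains exactly
    [g ^ 2] points, either all in its central cell (collapsed) or one in each cell
    of a [g] x [g] grid around the middle of the block (spread), arranged in the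
    order of their indices. Toggling between the two shapes in any set of good
    blocks is a bijection of the assignments.

    The geometric core is that spreading a collapsed cluster lengthens the optimal
    tour by at least one cell side, whatever the other points are
    ([tour_collapse]). Indeed an optimal tour leaves an isolated cluster at most
    twice ([few_exits]): by 2-optimality any two edges that leave it point in
    nearly opposite directions, and no three directions are pairwise nearly
    opposite. So all but two of the edges starting in the cluster stay in it, and
    as [g ^ 2] grid steps outweigh a few diameters of a grid of [g] steps a side,
    visiting the points in the same order after the collapse is cheaper
    ([collapse_gain]). This is where the dimension has to be at least 2.

    Therefore the length, as a function of the set of spread good blocks, increases
    by a fixed amount in the direction of every good block. As in Erdos' proof of the
    Littlewood-Offord inequality, such a function on the [k]-dimensional cube takes
    values in an interval of length of order [sqrt k] times the increment on at
    most 7/8 of the cube ([increasing_anticoncentration]). Finally the expected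
    number of good blocks is of order [n] and there are at most of order [n]
    blocks, so with probability bounded below there are of order [n] good ones
    ([good_blocks_lower], [many_large]). *)

Set Implicit Arguments.
Unset Strict Implicit.
Unset Printing Implicit Defensive.

Import Order.TTheory GRing.Theory Num.Theory.
Import numFieldNormedType.Exports.
Local Open Scope ring_scope.

(** * Binomial weights *)

Lemma central_binS m :
  ('C(m.+1.*2, m.+1) * m.+1 = 2 * m.*2.+1 * 'C(m.*2, m))%N.
Proof.
have e1 : 'C(m.*2.+1, m.+1) = 'C(m.*2.+1, m).
  by rewrite -[LHS]bin_sub; [congr 'C(_, _); lia|lia].
have e2 : (m.*2.+1 * 'C(m.*2, m) = m.+1 * 'C(m.*2.+1, m.+1))%N.
  exact: mul_bin_diag.
by rewrite doubleS binS -e1; nia.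
Qed.

Lemma central_bin_bound m : ('C(m.*2, m) ^ 2 * m.*2.+1 <= 16 ^ m)%N.
Proof.
elim: m => [|m IH]; first by rewrite bin0.
have e := central_binS m.
rewrite (expnS 16) -(@leq_pmul2r (m.+1 ^ 2)) ?expn_gt0//.
have -> : ('C(m.+1.*2, m.+1) ^ 2 * m.+1.*2.+1 * m.+1 ^ 2 =
   ('C(m.*2, m) ^ 2 * m.*2.+1) * (4 * m.*2.+1 * m.+1.*2.+1))%N.
  transitivity (('C(m.+1.*2, m.+1) * m.+1) ^ 2 * m.+1.*2.+1)%N; first by ring.
  by rewrite e; ring.
apply: (leq_trans (leq_mul IH (leqnn _))).
have h : (4 * m.*2.+1 * m.+1.*2.+1 <= 16 * m.+1 ^ 2)%N by nia.
apply: (leq_trans (leq_mul (leqnn _) h)).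
by rewrite mulnCA !mulnA.
Qed.

(** The largest weight among [2 ^ k] is thus at most [2 ^ k / sqrt k]. *)
Lemma bin_half_bound k : ('C(k, k./2) ^ 2 * k <= 4 ^ k)%N.
Proof.
have hm := central_bin_bound k./2.
have e4 : (4 ^ k./2.*2 = 16 ^ k./2)%N by rewrite -mul2n expnM.
have := odd_double_half k; move: hm e4; move: k./2 (odd k) => m [] hm e4 <-.
  rewrite add1n (expnS 4) e4.
  have hC : ('C(m.*2.+1, m) <= 2 * 'C(m.*2, m))%N.
    case: m {hm e4} => [|m]; first by rewrite !bin0.
    rewrite binS.
    suff: ('C(m.+1.*2, m) <= 'C(m.+1.*2, m.+1))%N by lia.
    have := @mul_bin_left m.+1.*2 m.
    have -> : (m.+1.*2 - m = m.+2)%N by lia.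
    by nia.
  apply: (@leq_trans ((2 * 'C(m.*2, m)) ^ 2 * m.*2.+1)%N).
    by rewrite leq_mul2r leq_sqr hC orbT.
  by rewrite expnMn -mulnA leq_mul2l hm.
rewrite add0n e4; apply: leq_trans hm.
by rewrite leq_mul2l leqnSn orbT.
Qed.

Lemma bin_monotone k w w' : (w <= w' <= k./2)%N -> ('C(k, w) <= 'C(k, w'))%N.
Proof.
case/andP=> /subnKC <-; elim: (w' - w)%N => [|j IH] h; first by rewrite addn0.
apply: (leq_trans (IH _)); first by lia.
rewrite addnS.
have := @mul_bin_left k (w + j).
have h2 : ((w + j).+1 <= k - (w + j))%N by lia.
by nia.
Qed.

Lemma lower_half_bin_sum k :
  (2 ^ k <= 2 * \sum_(w < k.+1 | w <= k./2) 'C(k, w))%N.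
Proof.
have -> : (2 ^ k = \sum_(w < k.+1) 'C(k, w))%N.
  rewrite -[2%N]/(1 + 1)%N expnDn.
  by apply: eq_bigr => i _; rewrite !exp1n !muln1.
rewrite (bigID (fun w : 'I_k.+1 => (w <= k./2)%N)) /= mul2n -addnn leq_add2l.
rewrite (reindex_inj rev_ord_inj) /=.
rewrite [leqLHS](eq_bigl (fun w : 'I_k.+1 => (w < k - k./2)%N)); last first.
  by move=> w; rewrite /= subSS; have := ltn_ord w; lia.
rewrite [leqLHS](eq_bigr (fun w : 'I_k.+1 => 'C(k, w))); last first.
  by move=> w _; rewrite subSS bin_sub// -ltnS.
rewrite [leqRHS](bigID (fun w : 'I_k.+1 => (w < k - k./2)%N)) /=.
apply: leq_trans (leq_addr _ _).
rewrite [leqRHS](eq_bigl (fun w : 'I_k.+1 => (w < k - k./2)%N)) // => w.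
by have := odd_double_half k; lia.
Qed.

(** Weigh the levels of the [k]-cube by the binomial coefficients; a set of
    levels with no two at distance [T] has at most 7/8 of the mass when [T] is
    small against [sqrt k]: shifting the lower half of the levels up by [T]
    does not decrease their weights, and only [T] levels of this half, each of
    weight at most [2 ^ k / sqrt k], are moved beyond the middle. *)
Lemma gapped_levels_mass k T (G : nat -> bool) : (16 * T ^ 2 <= k)%N ->
  (forall w, (w + T <= k)%N -> ~~ (G w && G (w + T)%N)) ->
  (8 * \sum_(w < k.+1) 'C(k, w) * G w <= 7 * 2 ^ k)%N.
Proof.
move=> hT hG; set h := k./2.
have hTh : (T <= h)%N by rewrite /h; nia.
(* the weight of the levels that the shift moves beyond the middle *)
have lost : (4 * (T * 'C(k, h)) <= 2 ^ k)%N.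
  have e4 : ((2 ^ k) ^ 2 = 4 ^ k)%N by rewrite -expnM mulnC expnM.
  rewrite -leq_sqr e4; apply: leq_trans (bin_half_bound k).
  rewrite -/h 2!expnMn mulnA mulnC leq_mul2l; apply/orP; right.
  exact: hT.
pose H w := 'C(k, w) * ~~ G w.
have total : (\sum_(w < k.+1) 'C(k, w) * G w + \sum_(0 <= w < k.+1) H w = 2 ^ k)%N.
  rewrite big_mkord -big_split /= -[2%N]/(1 + 1)%N expnDn.
  apply: eq_bigr => w _.
  by rewrite /H !exp1n !muln1 -mulnDr; case: (G w) => /=; rewrite muln1.
have lower := lower_half_bin_sum k.
have {}lower : (2 ^ k <= 2 * \sum_(0 <= w < h.+1) 'C(k, w))%N.
  rewrite big_mkord (big_ord_widen k.+1 (fun w => 'C(k, w))); last by rewrite /h; lia.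
  exact: lower.
have split_lower : (\sum_(0 <= w < h.+1) 'C(k, w) <=
    \sum_(0 <= w < (h - T).+1) 'C(k, w) + T * 'C(k, h))%N.
  rewrite (@big_cat_nat _ _ _ (h - T).+1)//=; last by lia.
  rewrite leq_add2l.
  apply: (@leq_trans (\sum_((h - T).+1 <= w < h.+1) 'C(k, h))%N).
    rewrite big_nat_cond [leqRHS]big_nat_cond; apply: leq_sum => w /andP[/andP[h1 h2] _].
    by apply: bin_monotone; rewrite -ltnS h2 leqnn.
  by rewrite sum_nat_const_nat leq_mul2r; apply/orP; right; lia.
have paired : (\sum_(0 <= w < (h - T).+1) 'C(k, w) <=
    \sum_(0 <= w < (h - T).+1) H w + \sum_(0 <= w < (h - T).+1) H (w + T))%N.
  rewrite -big_split /= big_nat_cond [leqRHS]big_nat_cond.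
  apply: leq_sum => w /andP[/andP[_ hw] _]; rewrite /H.
  have hwT : (w + T <= h)%N by lia.
  have := @bin_monotone k w (w + T); rewrite -/h hwT leq_addr => /(_ isT) hm.
  have := hG w; have -> : (w + T <= k)%N by rewrite /h in hwT; lia.
  move=> /(_ isT); case: (G w) => /=; case: (G (w + T)%N) => //= _; lia.
have sum1 : (\sum_(0 <= w < (h - T).+1) H w <= \sum_(0 <= w < k.+1) H w)%N.
  rewrite [leqRHS](@big_cat_nat _ _ _ (h - T).+1)//= ?leq_addr//.
  by rewrite /h; lia.
have sum2 : (\sum_(0 <= w < (h - T).+1) H (w + T) <= \sum_(0 <= w < k.+1) H w)%N.
  have -> : (\sum_(0 <= w < (h - T).+1) H (w + T) = \sum_(T <= w < h.+1) H w)%N.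
    rewrite [RHS](_ : _ = \sum_(0 + T <= w < h.+1) H w)%N // big_addn.
    by rewrite subSn.
  rewrite [leqRHS](@big_cat_nat _ _ _ T)//=; last by rewrite /h in hTh *; lia.
  rewrite [X in (_ <= _ + X)%N](@big_cat_nat _ _ _ h.+1)//=; last 2 first.
  - by lia.
  - by rewrite /h; lia.
  by rewrite addnCA leq_addr.
by lia.
Qed.

(** * Anticoncentration on the cube *)

Section SetChain.
Variable J : finType.
Implicit Type B : {set J}.

(** For [w] up to [#|J|] these sets form a maximal chain. *)
Definition initial_set (w : nat) : {set J} := [set x | (index x (enum J) < w)%N].

Lemma initial_setS w : (w < #|J|)%N ->
  exists2 x, x \notin initial_set w & initial_set w.+1 = x |: initial_set w.
Proof.
rewrite cardE => hw; have [x0 _] : exists x0, x0 \in enum J.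
  by move: hw; case: (enum J) => // y s _; exists y; rewrite mem_head.
have ux := enum_uniq J.
exists (nth x0 (enum J) w); first by rewrite inE index_uniq// ltnn.
apply/setP => y; rewrite !inE ltnS leq_eqVlt; congr (_ || _).
by apply/eqP/eqP => [<-|->]; rewrite ?nth_index ?mem_enum ?index_uniq.
Qed.

Lemma initial_set_image B :
  exists t : {perm J}, B = t @: initial_set #|B|.
Proof.
pose s := enum B ++ enum (~: B).
have su : uniq s.
  rewrite cat_uniq !enum_uniq andbT /=; apply/hasPn => x.
  by rewrite !mem_enum inE.
have sm x : x \in s by rewrite mem_cat !mem_enum inE orbN.
have sz : size s = size (enum J).
  by rewrite size_cat -!cardE cardsC.
have hx x : (index x (enum J) < size s)%N by rewrite sz index_mem mem_enum.
pose g x := nth x s (index x (enum J)).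
have gE x y : g x = nth y s (index x (enum J)) by exact: set_nth_default.
have ginj : injective g.
  move=> x y; rewrite (gE x x) (gE y x) => /eqP.
  rewrite nth_uniq// => /eqP e; apply: (@index_inj _ x (enum J)); rewrite ?mem_enum//.
exists (perm ginj); apply/setP => y; apply/idP/imsetP => [yB|[x]].
  have yi : (index y s < size s)%N by rewrite index_mem.
  pose x := nth y (enum J) (index y s).
  have xi : index x (enum J) = index y s by rewrite index_uniq ?enum_uniq// -sz.
  exists x; last by rewrite permE (gE x y) xi nth_index.
  rewrite inE xi /s index_cat mem_enum yB cardE index_mem mem_enum.
  by [].
rewrite inE => xi ->; rewrite permE /g /s nth_cat -cardE xi.
by rewrite -(@mem_enum _ B) mem_nth// -cardE.
Qed.

(** Averaging over all relabellings of the ground set turns the sum over the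
    subsets into a sum along the levels of a single maximal chain. *)
Lemma sum_over_chains (A : pred {set J}) :
  (#|A| * #|{perm J}| =
   \sum_(t : {perm J}) \sum_(w < #|J|.+1) 'C(#|J|, w) * A (t @: initial_set w))%N.
Proof.
transitivity (\sum_(t : {perm J}) \sum_(B : {set J}) A (t @: B))%N.
  rewrite (eq_bigr (fun=> #|A|)); first by rewrite sum_nat_const mulnC.
  move=> t _; rewrite -sum1_card [RHS]big_mkcond/=.
  rewrite [RHS](reindex_inj (imset_inj (@perm_inj _ t)))/=.
  by apply: eq_bigr => B _; rewrite unfold_in; case: (A _).
rewrite exchange_big/= [RHS]exchange_big/=.
transitivity (\sum_(B : {set J}) \sum_(t : {perm J}) A (t @: initial_set #|B|))%N.
  apply: eq_bigr => B _; have [u {1}->] := initial_set_image B.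
  rewrite [RHS](reindex_inj (mulgI u))/=.
  apply: eq_bigr => t _; congr (nat_of_bool (A _)).
  by rewrite -imset_comp; apply: eq_imset => x; rewrite /= permM.
have hB B : (#|B| < #|J|.+1)%N by rewrite ltnS max_card.
rewrite (partition_big (fun B => inord #|B| : 'I_(#|J|).+1) predT)//=.
apply: eq_bigr => w _; rewrite -big_distrr/=.
rewrite (eq_bigl (fun B => B \in [set B : {set J} | #|B| == w])); last first.
  by move=> B; rewrite inE -val_eqE /= inordK.
rewrite -(@card_draws J w) -[#|finset _|]sum1_card big_distrl/=.
by apply: eq_bigr => B; rewrite inE => /eqP ->; rewrite mul1n.
Qed.

End SetChain.

Section Anticoncentration.
Variable R : realDomainType.
Implicit Types (J I : finType) (a b delta : R).

Lemma chain_increase J (f : {set J} -> R) delta (t : {perm J}) w j :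
  (forall (B : {set J}) i, i \notin B -> f B + delta <= f (i |: B)) ->
  (w + j <= #|J|)%N ->
  f (t @: initial_set J w) + j%:R * delta <= f (t @: initial_set J (w + j)).
Proof.
move=> hf; elim: j => [|j IH] hj; first by rewrite mul0r addr0 addn0.
rewrite addnS in hj *.
have [x xN ->] := initial_setS hj.
rewrite imsetU1; apply: le_trans (hf _ _ _); last by rewrite mem_imset//; exact: perm_inj.
by rewrite -natr1 mulrDl mul1r addrA lerD2r IH// ltnW.
Qed.

(** A function on the cube that grows by [delta] along every edge meets an
    interval of length less than [T * delta], with [T] of order the square root
    of the dimension, in at most 7/8 of the vertices: two vertices of a chain
    that lie [T] levels apart cannot both be mapped to the interval. *)
Lemma increasing_anticoncentration J (f : {set J} -> R) delta a b (T : nat) :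
  (forall (B : {set J}) i, i \notin B -> f B + delta <= f (i |: B)) ->
  (16 * T ^ 2 <= #|J|)%N -> b - a < T%:R * delta ->
  (8 * #|[set B : {set J} | (a <= f B <= b)%R]| <= 7 * 2 ^ #|J|)%N.
Proof.
move=> hf hT hab.
have p0 : (0 < #|{perm J}|)%N by apply/card_gt0P; exists 1%g.
rewrite -(leq_pmul2r p0) -mulnA cardsE sum_over_chains.
rewrite big_distrr/= [leqRHS]mulnC -sum_nat_const.
apply: leq_sum => t _.
apply: (@gapped_levels_mass #|J| T (fun w =>
  a <= f (t @: initial_set J w) <= b) hT) => w hw.
apply/negP => /andP[/andP[h1 _] /andP[_ h2]].
have := chain_increase t hf hw; apply/negP; rewrite -ltNge.
apply: le_lt_trans h2 _; rewrite -ltrBDl; apply: le_lt_trans hab.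
by rewrite lerD2l lerN2.
Qed.

(** For each choice of the part of the argument outside [S], the previous bound
    applies to the part inside. *)
Lemma partial_anticoncentration I (S : {set I}) (f : {set I} -> R) delta a b
    (T : nat) :
  (forall (B : {set I}) i, i \in S -> i \notin B -> f B + delta <= f (i |: B)) ->
  (16 * T ^ 2 <= #|S|)%N -> b - a < T%:R * delta ->
  (8 * #|[set B : {set I} | (a <= f B <= b)%R]| <= 7 * 2 ^ #|I|)%N.
Proof.
move=> hf hT hab; pose J := {x : I | x \in S}.
have cJ : #|{: J}| = #|S| by rewrite card_sig.
have eS (x : J) : Sub (val x) (valP x) = x by apply: val_inj; rewrite SubK.
have nS : (#|~: S| + #|S|)%N = #|I| by rewrite addnC cardsC.
have key (D : {set I}) : D \subset ~: S ->
    (8 * (\sum_(B : {set I} | B :\: S == D) (a <= f B <= b)%R) <= 7 * 2 ^ #|S|)%N.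
  move=> hD; have DS x : x \in D -> x \notin S by move/(fintype.subsetP hD); rewrite inE.
  pose h (C : {set J}) := D :|: [set val x | x in C].
  have hS x (xS : x \in S) C : (x \in h C) = (Sub x xS \in C).
    rewrite inE; apply/orP/idP => [[/DS|/imsetP[y yC e]]|xC].
    - by rewrite xS.
    - by have -> : Sub x xS = y by [apply: val_inj; rewrite SubK].
    - by right; apply/imsetP; exists (Sub x xS); rewrite ?SubK.
  have hN x : x \notin S -> forall C, (x \in h C) = (x \in D).
    move=> xS C; rewrite inE; case: (x \in D) => //=.
    by apply/imsetP => -[y _ e]; move: xS; rewrite e (valP y).
  rewrite (reindex h) /=; last first.
    exists (fun B : {set I} => [set x : J | val x \in B]) => [C _|B].
      by apply/setP => x; rewrite inE (hS _ (valP x)) eS.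
    rewrite inE => /eqP e; apply/setP => x.
    case: (boolP (x \in S)) => xS; first by rewrite (hS _ xS) inE SubK.
    by rewrite (hN _ xS) -e inE xS.
  rewrite (eq_bigl predT); last first.
    move=> C; apply/eqP/setP => x; rewrite inE.
    case: (boolP (x \in S)) => xS /=; last by rewrite hN.
    by apply/esym/negbTE; apply: contraL xS; exact: DS.
  have := @increasing_anticoncentration J (f \o h) delta a b T.
  rewrite cJ => /(_ _ hT hab) hh.
  apply: leq_trans (hh _); last first.
    move=> C i iC /=; have -> : h (i |: C) = val i |: h C.
      by rewrite /h imsetU1 !finset.setUA (finset.setUC D).
    by apply: hf; rewrite ?(valP i)// (hS _ (valP i)) eS.
  rewrite leq_mul2l /= -sum1dep_card [leqRHS]big_mkcond/=.
  by apply: leq_sum => C _; case: ifP.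
rewrite -sum1dep_card [X in (8 * X)%N]big_mkcond/=.
rewrite (eq_bigr (fun B : {set I} => nat_of_bool (a <= f B <= b))); last first.
  by move=> B _; case: ifP.
rewrite (partition_big (fun B : {set I} => B :\: S) (fun D => D \subset ~: S))/=; last first.
  by move=> B _; apply/fintype.subsetP => x; rewrite !inE => /andP[].
rewrite big_distrr/=.
apply: leq_trans (leq_sum (index_enum _) key) _.
rewrite (eq_bigl (fun D => D \in powerset (~: S))) => [|D]; last by rewrite powersetE.
by rewrite sum_nat_const card_powerset -nS expnD mulnCA.
Qed.

End Anticoncentration.

(** * Toggling the shapes of clusters *)

Section ClusterFlips.
Variables (n : nat) (Cell Block : finType) (blk : Cell -> Block).
Variables (ctr : Block -> Cell) (spr : Block -> nat -> Cell) (K : nat).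
Hypothesis blk_ctr : forall Q, blk (ctr Q) = Q.
Hypothesis blk_spr : forall Q r, blk (spr Q r) = Q.
Hypothesis spr_neq_ctr : forall Q r, spr Q r != ctr Q.
Hypothesis K_gt0 : (0 < K)%N.

Local Notation config := {ffun 'I_n -> Cell}.
Implicit Types (z : config) (Q : Block) (B : {set Block}).

Definition occupants z Q : {set 'I_n} := [set i | blk (z i) == Q].

(** The order of the indices decides which point of a block takes which place in the
    grid, so that collapsing a cluster can be undone. *)
Definition rank_in_block z (i : 'I_n) : nat :=
  #|[set j in occupants z (blk (z i)) | (j < i)%N]|.

Definition collapsed z Q :=
  (#|occupants z Q| == K) && [forall i in occupants z Q, z i == ctr Q].

Definition spread z Q :=
  (#|occupants z Q| == K) &&
  [forall i in occupants z Q, z i == spr Q (rank_in_block z i)].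

Definition good_blocks z : {set Block} := [set Q | collapsed z Q || spread z Q].

Definition flip B z : config := [ffun i =>
  if (blk (z i) \in B) && spread z (blk (z i)) then ctr (blk (z i))
  else if (blk (z i) \in B) && collapsed z (blk (z i))
       then spr (blk (z i)) (rank_in_block z i)
  else z i].

Lemma blk_flip B z i : blk (flip B z i) = blk (z i).
Proof. by rewrite ffunE; case: ifP => [_|_]; last case: ifP. Qed.

Lemma occupants_flip B z Q : occupants (flip B z) Q = occupants z Q.
Proof. by apply/setP => i; rewrite !inE blk_flip. Qed.

Lemma rank_flip B z i : rank_in_block (flip B z) i = rank_in_block z i.
Proof. by rewrite /rank_in_block blk_flip occupants_flip. Qed.

Lemma collapsed_not_spread z Q : collapsed z Q -> spread z Q = false.
Proof.
move=> /andP[/eqP hK /forall_inP h]; apply/negP => /andP[_ /forall_inP h'].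
have /card_gt0P[i iQ] : (0 < #|occupants z Q|)%N by rewrite hK.
by have := spr_neq_ctr Q (rank_in_block z i); rewrite -(eqP (h' i iQ)) (eqP (h i iQ)) eqxx.
Qed.

Lemma collapsed_flip B z Q :
  collapsed (flip B z) Q = if Q \in B then spread z Q else collapsed z Q.
Proof.
case: ifP => QB.
- case: (boolP (spread z Q)) => hs.
    rewrite /collapsed occupants_flip; case/andP: (hs) => -> _ /=.
    apply/forall_inP => i; rewrite inE => /eqP e.
    by rewrite ffunE e QB hs.
  apply/negP => /andP[]; rewrite occupants_flip => hK /forall_inP h.
  have /card_gt0P[i iQ] : (0 < #|occupants z Q|)%N by rewrite (eqP hK).
  have e : blk (z i) = Q by move: iQ; rewrite inE => /eqP.
  case: (boolP (collapsed z Q)) => hc.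
    have := h i iQ; rewrite ffunE e QB (negbTE hs) hc /=.
    by apply/negP; exact: spr_neq_ctr.
  move/negP: hc; apply; rewrite /collapsed hK; apply/forall_inP => j jQ.
  have ej : blk (z j) = Q by move: jQ; rewrite inE => /eqP.
  have := h j jQ; rewrite ffunE ej QB (negbTE hs) /=; case: ifP => // hc.
  by move/eqP => e2; have := spr_neq_ctr Q (rank_in_block z j); rewrite e2 eqxx.
- rewrite /collapsed occupants_flip; congr (_ && _).
  apply: eq_forallb => i; rewrite inE; case: eqP => //= e.
  by rewrite ffunE e QB.
Qed.

Lemma spread_flip B z Q :
  spread (flip B z) Q = if Q \in B then collapsed z Q else spread z Q.
Proof.
case: ifP => QB.
- case: (boolP (collapsed z Q)) => hc.
    have hs := collapsed_not_spread hc.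
    rewrite /spread occupants_flip; case/andP: (hc) => -> _ /=.
    apply/forall_inP => i; rewrite inE => /eqP e.
    by rewrite rank_flip ffunE e QB hs hc.
  apply/negP => /andP[]; rewrite occupants_flip => hK /forall_inP h.
  have /card_gt0P[i iQ] : (0 < #|occupants z Q|)%N by rewrite (eqP hK).
  have e : blk (z i) = Q by move: iQ; rewrite inE => /eqP.
  case: (boolP (spread z Q)) => hs.
    have := h i iQ; rewrite ffunE e QB hs /= eq_sym.
    by apply/negP; exact: spr_neq_ctr.
  move/negP: hs; apply; rewrite /spread hK; apply/forall_inP => j jQ.
  have ej : blk (z j) = Q by move: jQ; rewrite inE => /eqP.
  have := h j jQ; rewrite rank_flip ffunE ej QB (negbTE hc) /=; case: ifP => // hs.
  rewrite eq_sym => /eqP e2.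
  by have := spr_neq_ctr Q (rank_in_block z j); rewrite e2 eqxx.
- rewrite /spread occupants_flip; congr (_ && _).
  apply: eq_forallb => i; rewrite inE; case: eqP => //= e.
  by rewrite rank_flip ffunE e QB.
Qed.

Lemma flipK B : involutive (flip B).
Proof.
move=> z; apply/ffunP => i; rewrite ffunE blk_flip spread_flip collapsed_flip.
rewrite rank_flip; set Q := blk (z i); case: (boolP (Q \in B)) => QB /=.
  case: (boolP (collapsed z Q)) => [/andP[_ /forall_inP hc]|hc].
    by rewrite (eqP (hc i _)) // inE.
  case: (boolP (spread z Q)) => [/andP[_ /forall_inP hs]|hs].
    by rewrite (eqP (hs i _)) // inE.
  by rewrite ffunE -/Q QB (negbTE hc) (negbTE hs).
by rewrite ffunE -/Q (negbTE QB).
Qed.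

Section Concentration.
Variables (R : realDomainType) (F : config -> R) (delta : R).
Hypothesis F_collapse : forall z z' Q,
  (forall i, blk (z' i) = blk (z i)) ->
  (forall i, blk (z i) != Q -> z' i = z i) ->
  collapsed z Q -> spread z' Q -> F z + delta <= F z'.

(** With all other blocks left as they are, the choice of the set of flipped
    blocks is, up to a symmetric difference with the blocks that are spread in
    [z], the choice of the set of spread good blocks, in which [F] increases. *)
Lemma flip_anticoncentration z a b T :
  (16 * T ^ 2 <= #|good_blocks z|)%N -> b - a < T%:R * delta ->
  (8 * #|[set B | (a <= F (flip B z) <= b)%R]| <= 7 * 2 ^ #|Block|)%N.
Proof.
move=> hT hab.
pose st := [set Q | spread z Q].
pose sd B := [set Q | (Q \in B) (+) (Q \in st)].
have sdK : involutive sd by move=> B; apply/setP => Q; rewrite !inE addbK.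
have := @partial_anticoncentration R _ (good_blocks z)
  (fun B => F (flip (sd B) z)) delta a b T.
move=> /(_ _ hT hab) h.
have -> : #|[set B | a <= F (flip B z) <= b]| =
          #|[set B | a <= F (flip (sd B) z) <= b]|.
  rewrite -(card_imset _ (inv_inj sdK)); apply: eq_card => B.
  rewrite inE; apply/imsetP/idP => [[D + ->]|hB]; first by rewrite inE sdK.
  by exists (sd B); rewrite ?inE ?sdK.
apply: h => B Q; rewrite inE => gQ QB.
have other P : P != Q -> (P \in sd (Q |: B)) = (P \in sd B).
  by move=> PQ; rewrite !inE (negbTE PQ).
apply: (@F_collapse _ _ Q).
- by move=> i; rewrite !blk_flip.
- by move=> i; rewrite blk_flip => iQ; rewrite !ffunE other.
- rewrite collapsed_flip !inE (negbTE QB) /=.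
  by case: (spread z Q) gQ; rewrite ?orbF.
- rewrite spread_flip !inE eqxx /=.
  by case: (spread z Q) gQ; rewrite ?orbF.
Qed.

(** For each set of blocks, flipping it permutes the configurations; so the proportion
    of configurations sent to the interval is the average, over configurations
    [z], of the proportion of the flips of [z] sent to it. *)
Lemma config_anticoncentration a b T : b - a < T%:R * delta ->
  (8 * #|[set z : config | (a <= F z <= b)%R]| +
   #|[set z : config | (16 * T ^ 2 <= #|good_blocks z|)%N]| <= 8 * #|{: config}|)%N.
Proof.
move=> hab; set N := #|Block|.
have p2 : (0 < 2 ^ N)%N by rewrite expn_gt0.
rewrite -(leq_pmul2r p2) mulnDl.
have -> : (8 * #|[set z : config | (a <= F z <= b)%R]| * 2 ^ N =
   \sum_(z : config) 8 * #|[set B | (a <= F (flip B z) <= b)%R]|)%N.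
  rewrite -big_distrr/= -mulnA; congr (8 * _)%N.
  under [RHS]eq_bigr do rewrite -sum1dep_card big_mkcond/=.
  rewrite exchange_big/=.
  rewrite (eq_bigr (fun=> #|[set z : config | (a <= F z <= b)%R]|)).
    by rewrite sum_nat_const mulnC; congr (_ * _)%N; rewrite -cardsT -powersetT card_powerset cardsT.
  move=> B _; rewrite -sum1dep_card [RHS]big_mkcond/=.
  by rewrite [RHS](reindex_inj (inv_inj (@flipK B))).
have -> : (#|[set z : config | (16 * T ^ 2 <= #|good_blocks z|)%N]| * 2 ^ N =
   \sum_(z : config) (16 * T ^ 2 <= #|good_blocks z|) * 2 ^ N)%N.
  rewrite -big_distrl/= -sum1dep_card big_mkcond/=.
  by congr (_ * _)%N; apply: eq_bigr => z _; case: ifP.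
rewrite -big_split/= [leqRHS]mulnAC [leqRHS]mulnC -sum_nat_const.
apply: leq_sum => z _; case: (boolP (16 * T ^ 2 <= _)%N) => hT.
  have := flip_anticoncentration hT hab.
  rewrite mul1n -/N -(leq_add2r (2 ^ N)%N) => /leq_trans; apply.
  by rewrite addnC -mulSn.
rewrite mul0n addn0 leq_mul2l /= /N -cardsT -card_powerset powersetT cardsT.
exact: max_card.
Qed.

End Concentration.

(** Exactly [K] points are in [Q], all in its central cell, and the other points
    choose among the cells outside [Q]. *)
Lemma card_collapsed Q :
  #|[set z : config | collapsed z Q]| =
  ('C(n, K) * (#|Cell| - #|[set c | blk c == Q]|) ^ (n - K))%N.
Proof.
rewrite -sum1_card (partition_big (fun z : config => occupants z Q)
  (fun J : {set 'I_n} => J \in [set A : {set 'I_n} | #|A| == K]))/=; last first.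
  by move=> z; rewrite !inE => /andP[].
rewrite (eq_bigr (fun=> (#|Cell| - #|[set c | blk c == Q]|) ^ (n - K)))%N; last first.
  move=> J; rewrite inE => /eqP hJ.
  pose D i := if i \in J then pred1 (ctr Q) else [predC [set c | blk c == Q]].
  have mD z : (z \in family D) =
      [forall i, if i \in J then z i == ctr Q else blk (z i) != Q].
    apply: eq_forallb => i; rewrite /finfun.fmem /D /=.
    by case: ifP => _; rewrite !inE.
  rewrite sum1dep_card cardsE (eq_card (B := family D)); last first.
    move=> z; rewrite mD unfold_in; apply/andP/forallP => [[hc /eqP hz] i|h].
      move: hc; rewrite inE => /andP[_ /forall_inP hc].
      by case: ifP; rewrite -hz => hi; [exact: hc|move: hi; rewrite inE => ->].
    have hz : occupants z Q = J.
      apply/setP => i; rewrite inE; have := h i.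
      by case: ifP => [_ /eqP ->|_ /negbTE //]; rewrite blk_ctr eqxx.
    rewrite hz eqxx; split=> //; rewrite inE /collapsed hz hJ eqxx /=.
    by apply/forall_inP => i iJ; have := h i; rewrite iJ.
  rewrite card_family foldrE big_map big_enum /=.
  rewrite (bigID (mem J))/= [X in (X * _)%N]big1 ?mul1n; last first.
    by move=> i iJ; rewrite /D iJ card1.
  rewrite (eq_bigr (fun=> (#|Cell| - #|[set c | blk c == Q]|)%N)); last first.
    move=> i iJ; rewrite /D (negbTE iJ) -[finset _]finset.setCK -cardsCs.
    by apply: eq_card => c; rewrite !inE negbK.
  rewrite prod_nat_const; congr (_ ^ _)%N.
  have := cardsC J; rewrite card_ord hJ => /(congr1 (subn^~ K)); rewrite addKn => <-.
  by apply: eq_card => i; rewrite !inE.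
by rewrite sum_nat_const card_draws card_ord.
Qed.

End ClusterFlips.

(** * 2-opt exchanges in a tour *)

Section TwoOpt.
Variable n : nat.
Implicit Types i j k : 'I_n.

(** For [b < n] the default value [k] of [insubd] is not reached. *)
Definition reversal (a b : nat) k : 'I_n :=
  insubd k (if (a <= k <= b)%N then (a + b - k)%N else k : nat).

Lemma reversalE a b k : (b < n)%N ->
  reversal a b k = (if (a <= k <= b)%N then a + b - k else k)%N :> nat.
Proof.
move=> hb; rewrite val_insubd; case: ifP => //; case: ifP => [/andP[h1 h2]|_].
  by move/negbT; lia.
by rewrite ltn_ord.
Qed.

Lemma reversalK a b : (b < n)%N -> involutive (reversal a b).
Proof.
move=> hb k; apply: val_inj; rewrite /= !reversalE//.
case: (boolP (a <= k <= b)%N) => [/andP[h1 h2]|/negbTE -> //].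
by rewrite ifT; lia.
Qed.

Lemma ordSE k : ordS k = (if k.+1 == n then 0 else k.+1)%N :> nat.
Proof.
rewrite /=; case: eqP => [->|h]; first by rewrite modnn.
by rewrite modn_small//; have := ltn_ord k; lia.
Qed.

Variable R : realDomainType.
Variable D : 'I_n -> 'I_n -> R.
Hypothesis D_sym : forall i j, D i j = D j i.

Definition cycle_length (s : 'S_n) : R := \sum_(k < n) D (s k) (s (ordS k)).

(** Reversing the stretch of the tour between the positions [i] and [j]
    exchanges the two edges that leave these positions. *)
Lemma two_opt_exchange (s : 'S_n) i j : (i < j)%N -> exists s' : 'S_n,
  cycle_length s' + D (s i) (s (ordS i)) + D (s j) (s (ordS j)) =
  cycle_length s + D (s i) (s j) + D (s (ordS i)) (s (ordS j)).
Proof.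
move=> ij; have hj := ltn_ord j; have hj' : (j.-1 < n)%N by lia.
pose psi := reversal i.+1 j; pose phi := reversal i.+1 j.-1.
have psiK : involutive psi by exact: reversalK.
have phiK : involutive phi by exact: reversalK.
have psiE k : psi k = (if (i.+1 <= k <= j)%N then i.+1 + j - k else k)%N :> nat.
  exact: reversalE.
have phiE k : phi k = (if (i.+1 <= k <= j.-1)%N then i.+1 + j.-1 - k else k)%N :> nat.
  exact: reversalE.
have ji : j != i by rewrite -val_eqE /=; lia.
exists (perm (inv_inj psiK) * s)%g.
have sE k : (perm (inv_inj psiK) * s)%g k = s (psi k) by rewrite permM permE.
rewrite /cycle_length; under eq_bigr do rewrite !sE.
rewrite (bigD1 i)//= (bigD1 j)//= [in RHS](bigD1 i)//= [in RHS](bigD1 j)//=.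
have -> : psi i = i by apply: ord_inj; rewrite psiE; case: ifP => //; lia.
have -> : psi (ordS i) = j.
  apply: ord_inj; by rewrite psiE ordSE; case: eqVneq => ? /=; do ?[case: ifP => ?]; lia.
have -> : psi j = ordS i.
  by apply: ord_inj; rewrite psiE [RHS]ordSE; case: eqVneq => ? /=; do ?[case: ifP => ?]; lia.
have -> : psi (ordS j) = ordS j.
  by apply: ord_inj; rewrite psiE ordSE; case: eqVneq => ? /=; do ?[case: ifP => ?]; lia.
have -> : \sum_(k < n | (k != i) && (k != j)) D (s (psi k)) (s (psi (ordS k))) =
    \sum_(k < n | (k != i) && (k != j)) D (s k) (s (ordS k)).
  rewrite [RHS](reindex_inj (inv_inj phiK))/=.
  apply: eq_big => [k|k /andP[ki kj]].
    rewrite -!val_eqE /= phiE; case: ifP; lia.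
  have {}ki : (k : nat) <> i by move/eqP: ki; apply: contra_not => /ord_inj.
  have {}kj : (k : nat) <> j by move/eqP: kj; apply: contra_not => /ord_inj.
  have hk := ltn_ord k.
  case: (boolP (i < k < j)%N) => hkij.
    have phik : phi k = (i + j - k)%N :> nat by rewrite phiE ifT; lia.
    have -> : psi (ordS k) = phi k.
      apply: ord_inj; rewrite psiE phik ordSE; case: eqVneq => ? /=; do ?[case: ifP => ?]; lia.
    have -> : psi k = ordS (phi k); last exact: D_sym.
    apply: ord_inj; rewrite psiE ordSE phik; case: eqVneq => ? /=;
    do ?[case: ifP => ?]; lia.
  have -> : phi k = k by apply: ord_inj; rewrite phiE; case: ifP => //; lia.
  have -> : psi k = k by apply: ord_inj; rewrite psiE; case: ifP => //; lia.
  have -> : psi (ordS k) = ordS k; last by [].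
  by apply: ord_inj; rewrite psiE ordSE; case: eqVneq => ? /=; do ?[case: ifP => ?]; lia.
ring.
Qed.

Lemma two_opt_optimal (s : 'S_n) i j :
  (forall s', cycle_length s <= cycle_length s') -> i != j ->
  D (s i) (s (ordS i)) + D (s j) (s (ordS j)) <=
  D (s i) (s j) + D (s (ordS i)) (s (ordS j)).
Proof.
move=> opt; wlog ij : i j / (i < j)%N => [th|_].
  rewrite neq_ltn => /orP[ij|ji]; first by apply: th; rewrite // neq_ltn ij.
  rewrite (D_sym (s i) (s j)) (D_sym (s (ordS i)) (s (ordS j))) addrC.
  by apply: th; rewrite // neq_ltn ji.
have [s' e] := two_opt_exchange s ij.
have := opt s'; move: e.
set a := cycle_length s; set b := cycle_length s'.
set x := D (s i) _; set y := D (s j) _; set u := D (s i) _; set v := D _ _.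
move=> e ab; lra.
Qed.

End TwoOpt.

(** * Isolated clusters in an optimal tour *)

Section EuclideanGeometry.
Variables (R : realType) (d : nat).
Implicit Types (x y z : d.-tuple R) (u v : 'I_d -> R).

Lemma cauchy_schwarz u v :
  (\sum_k u k * v k) ^+ 2 <= (\sum_k u k ^+ 2) * (\sum_k v k ^+ 2).
Proof.
set A := \sum_k u k ^+ 2; set B := \sum_k v k ^+ 2; set C := \sum_k _ * _.
have B0 : 0 <= B by apply: sumr_ge0 => k _; exact: sqr_ge0.
have main : 0 <= B * (A * B - C ^+ 2).
  have -> : B * (A * B - C ^+ 2) = \sum_k (B * u k - C * v k) ^+ 2.
    under eq_bigr do rewrite sqrrB !exprMn.
    rewrite big_split sumrB /= -!mulr_sumr -/A -/B.
    rewrite (eq_bigr (fun k => (B * C *+ 2) * (u k * v k))); last by move=> k _; ring.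
    by rewrite -mulr_sumr -/C; ring.
  by apply: sumr_ge0 => k _; exact: sqr_ge0.
move: B0; rewrite le_eqVlt => /predU1P[B0|B0]; last first.
  by move: main; rewrite pmulr_rge0// subr_ge0.
have v0 k : v k = 0.
  have := @psumr_eq0P R _ predT (fun k => v k ^+ 2).
  move=> /(_ (fun k _ => sqr_ge0 (v k)) (esym B0) k isT) /eqP.
  by rewrite sqrf_eq0 => /eqP.
rewrite -B0 mulr0 /C big1 ?expr0n// => k _; by rewrite v0 mulr0.
Qed.

Lemma euclidean_dist_ge0 x y : 0 <= euclidean_dist x y.
Proof. exact: sqrtr_ge0. Qed.

Lemma euclidean_distC x y : euclidean_dist x y = euclidean_dist y x.
Proof.
by congr Num.sqrt; apply: eq_bigr => k _; rewrite -sqrrN opprB.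
Qed.

Lemma sqr_euclidean_dist x y :
  euclidean_dist x y ^+ 2 = \sum_(k < d) (tnth x k - tnth y k) ^+ 2.
Proof. by rewrite sqr_sqrtr//; apply: sumr_ge0 => k _; exact: sqr_ge0. Qed.

Lemma euclidean_dist_triangle y x z :
  euclidean_dist x z <= euclidean_dist x y + euclidean_dist y z.
Proof.
have d0 := euclidean_dist_ge0.
rewrite -(@ler_pXn2r _ 2)// ?nnegrE ?addr_ge0//.
rewrite sqrrD !sqr_euclidean_dist.
set A := \sum_(k < d) (tnth x k - tnth y k) ^+ 2.
set B := \sum_(k < d) (tnth y k - tnth z k) ^+ 2.
set C := \sum_(k < d) (tnth x k - tnth y k) * (tnth y k - tnth z k).
have -> : \sum_(k < d) (tnth x k - tnth z k) ^+ 2 = A + B + C *+ 2.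
  rewrite -sumrMnl -!big_split /=; apply: eq_bigr => k _; ring.
have hC : C <= euclidean_dist x y * euclidean_dist y z.
  apply: le_trans (ler_norm _) _.
  rewrite -(@ler_pXn2r _ 2)// ?nnegrE ?mulr_ge0//.
  by rewrite real_normK ?num_real// exprMn !sqr_euclidean_dist; exact: cauchy_schwarz.
by rewrite addrAC lerD2r lerD2l ler_pMn2r.
Qed.

(** By the law of cosines, a distance within [r / 4] of the sum of two lengths, both at
    least [r], forces the cosine of the angle below -1/2. *)
Lemma wide_angle u v (a b r E : R) :
  0 <= E -> 4 * E < r -> r <= a -> r <= b ->
  \sum_k u k ^+ 2 = a ^+ 2 -> \sum_k v k ^+ 2 = b ^+ 2 ->
  (a + b - E) ^+ 2 <= \sum_k (u k - v k) ^+ 2 ->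
  2 * (\sum_k u k * v k) < - (a * b).
Proof.
move=> E0 Er ra rb ua vb.
have -> : \sum_k (u k - v k) ^+ 2 = a ^+ 2 + b ^+ 2 - 2 * \sum_k u k * v k.
  rewrite -ua -vb mulr_sumr -big_split -sumrB /=; apply: eq_bigr => k _; ring.
set c := \sum_k _ => h; nra.
Qed.

(** Three vectors cannot pairwise make angles of more than 120 degrees: the sum of
    the corresponding unit vectors would have a negative square. *)
Lemma no_three_wide_angles (u1 u2 u3 : 'I_d -> R) (a1 a2 a3 : R) :
  0 < a1 -> 0 < a2 -> 0 < a3 ->
  \sum_k u1 k ^+ 2 = a1 ^+ 2 -> \sum_k u2 k ^+ 2 = a2 ^+ 2 ->
  \sum_k u3 k ^+ 2 = a3 ^+ 2 ->
  2 * (\sum_k u1 k * u2 k) < - (a1 * a2) ->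
  2 * (\sum_k u2 k * u3 k) < - (a2 * a3) ->
  2 * (\sum_k u1 k * u3 k) < - (a1 * a3) -> False.
Proof.
move=> p1 p2 p3 e1 e2 e3.
set c12 := \sum_k u1 k * u2 k; set c23 := \sum_k u2 k * u3 k.
set c13 := \sum_k u1 k * u3 k => h12 h23 h13.
have : 0 <= \sum_k (u1 k / a1 + u2 k / a2 + u3 k / a3) ^+ 2.
  by apply: sumr_ge0 => k _; exact: sqr_ge0.
have -> : \sum_k (u1 k / a1 + u2 k / a2 + u3 k / a3) ^+ 2 =
    3 + 2 * c12 / (a1 * a2) + 2 * c23 / (a2 * a3) + 2 * c13 / (a1 * a3).
  have -> : 3 = (a1 ^+ 2 / a1 ^+ 2 + a2 ^+ 2 / a2 ^+ 2 + a3 ^+ 2 / a3 ^+ 2) :> R.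
    by rewrite !divff ?sqrf_eq0 ?gt_eqF//; ring.
  rewrite -{1}e1 -{1}e2 -{1}e3 /c12 /c23 /c13 !mulr_sumr !mulr_suml -!big_split /=.
  by apply: eq_bigr => k _; field; rewrite !gt_eqF.
apply/negP; rewrite -ltNge.
have q (c a b : R) : 0 < a -> 0 < b -> 2 * c < - (a * b) -> 2 * c / (a * b) < -1.
  by move=> a0 b0 h; rewrite ltr_pdivrMr ?mulr_gt0// mulN1r.
have := q _ _ _ p1 p2 h12; have := q _ _ _ p2 p3 h23; have := q _ _ _ p1 p3 h13.
set y1 := _ / _; set y2 := _ / _; set y3 := _ / _; lra.
Qed.

End EuclideanGeometry.

Section ClusterCollapse.
Variables (R : realType) (d n : nat).
Implicit Types (x : 'I_n -> d.-tuple R) (J : {set 'I_n}) (s : 'S_n).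

Lemma optimal_tour_attained x : exists s,
  optimal_tour_length x = tour_length x s /\
  forall s', tour_length x s <= tour_length x s'.
Proof.
have [s _ hs] := @arg_minP _ _ _ (1%g : 'S_n) predT (tour_length x) isT.
exists s; split; last by move=> s'; exact: hs.
apply/eqP; rewrite eq_le; apply/andP; split; first exact: bigmin_le.
by apply: le_bigmin => *; exact: hs.
Qed.

Lemma optimal_tour_le x s : optimal_tour_length x <= tour_length x s.
Proof. exact: bigmin_le. Qed.

(** By 2-optimality, the endpoints of two edges leaving a far isolated cluster
    lie in nearly opposite directions, so that there is no room for a third. *)
Lemma few_exits x J s (r E : R) :
  (forall s', tour_length x s <= tour_length x s') ->
  (forall i j, i \in J -> j \in J -> euclidean_dist (x i) (x j) <= E) ->
  (forall i j, i \in J -> j \notin J -> r <= euclidean_dist (x i) (x j)) ->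
  12 * E < r ->
  (#|[set k | (s k \in J) && (s (ordS k) \notin J)]| <= 2)%N.
Proof.
move=> opt hE hr Er; rewrite leqNgt; apply/negP => /card_gt2P[k1 [k2 [k3 []]]].
rewrite !inE => -[/andP[i1 o1] /andP[i2 o2] /andP[i3 o3]] [n12 n23 n31].
have dC := @euclidean_distC R d.
have E0 : 0 <= E by apply: le_trans (hE _ _ i1 i1); exact: euclidean_dist_ge0.
have far k k' : s k \in J -> s (ordS k) \notin J -> s k' \in J ->
    s (ordS k') \notin J -> k != k' ->
    euclidean_dist (x (s (ordS k))) (x (s k1)) +
    euclidean_dist (x (s (ordS k'))) (x (s k1)) - 3 * E <=
    euclidean_dist (x (s (ordS k))) (x (s (ordS k'))).
  move=> ik ok ik' ok' kk'.
  have := two_opt_optimal (D := fun i j => euclidean_dist (x i) (x j))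
    (fun i j => dC _ _) opt kk'.
  have h1 := hE _ _ ik ik'; have h2 := hE _ _ ik i1; have h3 := hE _ _ ik' i1.
  have := euclidean_dist_triangle (x (s k)) (x (s (ordS k))) (x (s k1)).
  have := euclidean_dist_triangle (x (s k')) (x (s (ordS k'))) (x (s k1)).
  rewrite (dC (x (s (ordS k))) (x (s k))) (dC (x (s (ordS k'))) (x (s k'))).
  move: h1 h2 h3.
  move: (euclidean_dist _ _) => a1; move: (euclidean_dist _ _) => a2.
  move: (euclidean_dist _ _) => a3; move: (euclidean_dist _ _) => a4.
  move: (euclidean_dist _ _) => a5; move: (euclidean_dist _ _) => a6.
  move: (euclidean_dist _ _) => a7; move: (euclidean_dist _ _) => a8.
  by clear; lra.
pose a k := euclidean_dist (x (s (ordS k))) (x (s k1)).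
pose u k (l : 'I_d) := tnth (x (s (ordS k))) l - tnth (x (s k1)) l.
have ra k : s (ordS k) \notin J -> r <= a k by rewrite /a dC => ok; exact: hr.
have r0 : 0 < r by apply: le_lt_trans Er; rewrite mulr_ge0.
have ua k : \sum_l u k l ^+ 2 = a k ^+ 2 by rewrite sqr_euclidean_dist.
have wide k k' : s k \in J -> s (ordS k) \notin J -> s k' \in J ->
    s (ordS k') \notin J -> k != k' -> 2 * (\sum_l u k l * u k' l) < - (a k * a k').
  move=> ik ok ik' ok' kk'.
  apply: (@wide_angle _ _ _ _ _ _ r (3 * E)); rewrite ?ua ?mulr_ge0 ?ra//.
    by rewrite mulrA; move: Er; congr (_ * _ < _); ring.
  have -> : \sum_l (u k l - u k' l) ^+ 2 =
      euclidean_dist (x (s (ordS k))) (x (s (ordS k'))) ^+ 2.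
    rewrite sqr_euclidean_dist; apply: eq_bigr => l _; rewrite /u; ring.
  rewrite ler_pXn2r// ?nnegrE ?euclidean_dist_ge0 ?far//.
  have := ra _ ok; have := ra _ ok'; rewrite -/(a k) -/(a k').
  by move: (a k) (a k') E0 Er; clear; move=> p q; lra.
apply: (@no_three_wide_angles _ _ (u k1) (u k2) (u k3) (a k1) (a k2) (a k3));
  rewrite ?ua ?wide// ?(lt_le_trans r0) ?ra// eq_sym//.
Qed.

(** All but two of the points of the cluster are followed in the tour by a point
    of the cluster. Following the same order after the collapse shortens these
    edges from at least [h] to at most [eta], while the at most four edges between
    the cluster and the other points grow by at most the displacement [rho]. *)
Lemma collapse_gain x x' J (K : nat) (h eta rho r E : R) : (1 < K)%N -> #|J| = K ->
  (forall i, i \notin J -> x' i = x i) ->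
  (forall i j, i \in J -> j \in J -> i != j -> h <= euclidean_dist (x i) (x j)) ->
  (forall i j, i \in J -> j \in J -> euclidean_dist (x' i) (x' j) <= eta) ->
  (forall i, i \in J -> euclidean_dist (x i) (x' i) <= rho) ->
  (forall i j, i \in J -> j \in J -> euclidean_dist (x i) (x j) <= E) ->
  (forall i j, i \in J -> j \notin J -> r <= euclidean_dist (x i) (x j)) ->
  12 * E < r -> eta <= h ->
  optimal_tour_length x' + ((K%:R - 2) * (h - eta) - 4 * rho) <=
  optimal_tour_length x.
Proof.
move=> K1 JK same hh heta hrho hE hr Er etah.
have [s [-> opt]] := optimal_tour_attained x.
have exits := few_exits opt hE hr Er.
have [j0 j0J] : exists j, j \in J by apply/card_gt0P; rewrite JK; lia.
have rho0 : 0 <= rho by apply: le_trans (hrho _ j0J); exact: euclidean_dist_ge0.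
apply: le_trans (lerD (optimal_tour_le x' s) (lexx _)) _.
pose S := [set k | s k \in J]; pose N := [set k | s (ordS k) \in J].
have cS : #|S| = K.
  by rewrite -JK -(card_preimset J (@perm_inj _ s)); apply: eq_card => k; rewrite !inE.
have cN : #|N| = K.
  rewrite -JK -(card_preimset J (inj_comp (@perm_inj _ s) (@ordS_inj n))).
  by apply: eq_card => k; rewrite !inE.
have cSN : (#|S :\: N| <= 2)%N.
  by apply: leq_trans exits; apply: subset_leq_card; apply/fintype.subsetP => k; rewrite !inE andbC.
have cI := cardsID N S; have cI' := cardsID S N.
have edge k : euclidean_dist (x' (s k)) (x' (s (ordS k))) <=
    euclidean_dist (x (s k)) (x (s (ordS k)))
    - (h - eta) * (k \in S :&: N)%:R + rho * (k \in S :\: N)%:R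
    + rho * (k \in N :\: S)%:R.
  have n2 : (1 < n)%N by apply: leq_trans K1 _; rewrite -JK -[n in leqRHS]card_ord max_card.
  have next : ordS k != k by apply/eqP => /(congr1 (@nat_of_ord n)); rewrite ordSE; have := ltn_ord k; case: eqVneq; lia.
  have move1 i j : i \in J -> j \notin J ->
      euclidean_dist (x' i) (x' j) <= euclidean_dist (x i) (x j) + rho.
    move=> iJ jJ; rewrite (same _ jJ).
    apply: le_trans (euclidean_dist_triangle (x i) _ _) _.
    by rewrite addrC lerD2l euclidean_distC hrho.
  rewrite !inE; case: (boolP (s k \in J)) => k1; case: (boolP (s (ordS k) \in J)) => k2 /=;
    rewrite ?mulr1 ?mulr0 ?addr0 ?subr0.
  - have kk : s k != s (ordS k) by rewrite (inj_eq (@perm_inj _ s)) eq_sym.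
    have := heta _ _ k1 k2; have := hh _ _ k1 k2 kk.
    by move: (euclidean_dist _ _) (euclidean_dist _ _); clear; move=> *; lra.
  - exact: move1.
  - by rewrite euclidean_distC (euclidean_distC (x (s k))); exact: move1.
  - by rewrite !same.
apply: le_trans (lerD (ler_sum _ (fun k _ => edge k)) (lexx _)) _.
have ind (A : {set 'I_n}) : \sum_(k < n) (k \in A)%:R = #|A|%:R :> R.
  by rewrite -natr_sum -sum1_card [in RHS]big_mkcond.
rewrite !big_split /= -/(tour_length x s) sumrN -!mulr_sumr !ind.
set e1 := #|S :\: N|; set e2 := #|N :\: S|; set m := #|S :&: N|.
have em : m%:R + e1%:R = K%:R :> R by rewrite -natrD cI cS.
have em' : m%:R + e2%:R = K%:R :> R by rewrite -natrD /m finset.setIC cI' cN.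
have e12 : e1%:R <= 2 :> R by rewrite ler_nat.
have e22 : e2%:R <= 2 :> R by move: em em' e12; clear; lra.
move: em em' e12 e22; move: (e1%:R) (e2%:R) (m%:R) (K%:R) (tour_length _ _).
move: rho0 etah; clear; move=> rho0 etah p q t k0 L e1 e2 h1 h2; nra.
Qed.

End ClusterCollapse.

(** * Relocation of a uniform real to another cell *)

Section UniformRelocation.
Local Open Scope classical_set_scope.
Variable R : realType.
Implicit Types (B A : set R) (m : nat).

Lemma lebesgue_translation (a : R) B : measurable B ->
  lebesgue_measure ((fun x => x + a) @^-1` B) = lebesgue_measure B.
Proof.
move=> mB.
have mf : measurable_fun setT (fun x : measurableTypeR R => x + a : measurableTypeR R).
  exact: measurable_funD.
pose mu := measure_function_pushforward__canonical__measure_function_Measure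
  (@lebesgue_measure R) mf.
rewrite (lebesgue_measure_unique (mu := mu) _ mB)//.
move=> _ [[u v] uv <-] /=.
rewrite /pushforward.
have -> : (fun x : R => x + a) @^-1` `]u, v] = `]u - a, v - a]%classic.
  by apply/seteqP; split=> x /=; rewrite !in_itv/= ltrBlDr lerBrDr.
rewrite !lebesgue_measure_itv/= !lte_fin ltrD2r; case: ifP => // _.
by rewrite -!EFinB; congr EFin; ring.
Qed.

(** The point of the [j]-th of [m] cells of the unit interval that has the offset of
    [x] within its own cell. *)
Definition relocate m (j : nat) (x : R) : R :=
  (j%:R + (m%:R * x - (Num.floor (m%:R * x))%:~R)) / m%:R.

Lemma measurable_relocate m j : measurable_fun setT (relocate m j).
Proof.
have mm : measurable_fun setT (fun x : R => m%:R * x) by exact: measurable_funM.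
apply: measurable_funM => //; apply: measurable_funD => //.
apply: measurable_funB => //.
apply: (@measurableT_comp _ _ _ _ _ _ (fun x : R => (Num.floor x)%:~R : R)) => //.
apply: nondecreasing_measurable => // x y xy.
by rewrite ler_int; apply: le_floor.
Qed.

Definition cell_itv m (i : nat) : set R := `[i%:R / m%:R, i.+1%:R / m%:R[.

Lemma measurable_cell_itv m i : measurable (cell_itv m i).
Proof. exact: measurable_itv. Qed.

Lemma lebesgue_split_cells m (S : set R) : (0 < m)%N -> measurable S ->
  lebesgue_measure (S `&` `[0, 1]) =
  (\sum_(i < m) lebesgue_measure (S `&` cell_itv m i))%E.
Proof.
move=> m0 mS; have m0' : (0 : R) < m%:R by rewrite ltr0n.
have step i : lebesgue_measure (S `&` `[0, i%:R / m%:R[%classic) =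
  (\sum_(l < i) lebesgue_measure (S `&` cell_itv m l))%E.
  elim: i => [|i IH].
    by rewrite big_ord0 mul0r set_itvco0 ?setI0 ?measure0//.
  rewrite big_ord_recr/= -IH -measureU; last 3 first.
  - exact: measurableI.
  - by apply: measurableI => //; exact: measurable_cell_itv.
  - apply/seteqP; split=> x //= -[[_]]; rewrite in_itv/= => /andP[_ h1] [_].
    by rewrite /cell_itv/= in_itv/= => /andP[]; rewrite leNgt h1.
  rewrite -setIUr; congr (lebesgue_measure (_ `&` _)).
  rewrite /cell_itv; apply/seteqP; split=> x /=; rewrite !in_itv/=.
    move=> /andP[x0 xi]; case: (ltP x (i%:R / m%:R)) => h; [left|right] => //.
    by rewrite x0.
  have hi : (i%:R / m%:R : R) < i.+1%:R / m%:R by rewrite ltr_pM2r ?invr_gt0// ltr_nat.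
  case=> /andP[x0 xi]; apply/andP; split => //; first exact: lt_trans xi hi.
  by apply: le_trans x0; rewrite divr_ge0.
rewrite -step divff ?gt_eqF//.
rewrite -[`[0, 1]%classic](@setUitv1 _ _ (BLeft 0) (1 : R) true); last by rewrite bnd_simp.
rewrite setIUr measureU; last 3 first.
- exact: measurableI.
- exact: measurableI.
- apply/seteqP; split=> x //= -[[_]]; rewrite in_itv/= => /andP[_ h1] [_ h2].
  by move: h1; rewrite h2 ltxx.
rewrite [X in (_ + X)%E](_ : _ = 0%E) ?adde0//.
apply/eqP; rewrite eq_le measure_ge0 andbT.
rewrite -(lebesgue_measure_set1 (1 : R)); apply: le_measure; rewrite ?inE//.
exact: measurableI.
Qed.

Lemma relocate_cell m (i j : nat) x : (0 < m)%N -> cell_itv m i x ->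
  relocate m j x = x + (j%:R - i%:R) / m%:R.
Proof.
move=> m0; have m0' : (0 : R) < m%:R by rewrite ltr0n.
rewrite /cell_itv/= in_itv/= ler_pdivrMr// ltr_pdivlMr// [x * _]mulrC => /andP[h1 h2].
rewrite /relocate; have -> : Num.floor (m%:R * x) = i%:Z.
  by apply: floor_def; rewrite -!pmulrn /= h1 /= -addn1 /= in h2 *; rewrite ?natz.
by field; rewrite gt_eqF.
Qed.

(** Averaged over the target cell, relocation preserves the uniform law on the unit
    interval: between two given cells it is a translation. *)
Lemma lebesgue_relocate_average m B : (0 < m)%N -> measurable B ->
  (\sum_(j < m) lebesgue_measure (relocate m j @^-1` B `&` `[0%R, 1%R]) =
   m%:R%:E * lebesgue_measure (B `&` `[0%R, 1%R]))%E.
Proof.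
move=> m0 mB; have m0' : (0 : R) < m%:R by rewrite ltr0n.
have mr j : measurable (relocate m j @^-1` B).
  by rewrite -[X in measurable X]setTI; exact: measurable_relocate.
under eq_bigr do rewrite (lebesgue_split_cells m0 (mr _)).
rewrite (lebesgue_split_cells m0 mB).
transitivity (\sum_(j < m) \sum_(i < m) lebesgue_measure (B `&` cell_itv m j))%E.
  apply: eq_bigr => j _; apply: eq_bigr => i _.
  rewrite -(@lebesgue_translation ((j%:R - i%:R) / m%:R) (B `&` cell_itv m j)); last first.
    by apply: measurableI => //; exact: measurable_cell_itv.
  congr lebesgue_measure; rewrite preimage_setI.
  have cellE x : cell_itv m i x <-> cell_itv m j (x + (j%:R - i%:R) / m%:R).
    rewrite /cell_itv/= !in_itv/= mulrBl addrA -!addrA.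
    rewrite -lerBlDr -ltrBrDr.
    have -> : j%:R / m%:R - (j%:R / m%:R - i%:R / m%:R) = i%:R / m%:R :> R by ring.
    have -> : j.+1%:R / m%:R - (j%:R / m%:R - i%:R / m%:R) = i.+1%:R / m%:R :> R.
      by rewrite -!natr1; ring.
    by [].
  apply/seteqP; split=> x /= [h1 h2].
    by split; [rewrite /= -(relocate_cell j m0 h2)|apply/cellE].
  by have h2' := (cellE x).2 h2; split=> //; rewrite /= (relocate_cell j m0 h2').
rewrite exchange_big/= sumr_const card_ord.
by rewrite mule_natl.
Qed.

End UniformRelocation.

(** * Relocation of a uniform sample *)

Section ProductLaw.
Local Open Scope classical_set_scope.
Variable R : realType.

Lemma tuple_lebesgue0 d : @tuple_lebesgue R d set0 = 0%E.
Proof.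
case: d => [|d]; first by rewrite /= /dirac indicE in_set0.
elim: d => [|d IH] /=; rewrite /pushforward preimage_set0; apply: integral0_eq => x _ /=.
  by rewrite xsection0 /= /dirac indicE in_set0.
by rewrite xsection0.
Qed.

Lemma tuple_lebesgue_rectangle d (B : 'I_d -> set R) :
  (forall k, measurable (B k)) ->
  tuple_lebesgue [set y : d.-tuple R | forall k, B k (tnth y k)] =
  (\prod_(k < d) lebesgue_measure (B k))%E.
Proof.
elim: d B => [|d IH] B mB.
  rewrite big_ord0 /= /dirac indicE.
  by rewrite mem_set//= => -[].
pose Q := [set y : d.-tuple R | forall k, B (lift ord0 k) (tnth y k)].
rewrite big_ord_recl -(IH (fun k => B (lift ord0 k)))// -/Q.
rewrite /= /pushforward.
have -> : (fun p : R * d.-tuple R => [tuple of p.1 :: p.2]) @^-1`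
    [set y : d.+1.-tuple R | forall k, B k (tnth y k)] = B ord0 `*` Q.
  apply/seteqP; split=> -[x y] /=.
    move=> h; split; first exact: (h ord0).
    by move=> k; have := h (lift ord0 k); rewrite tnthS.
  move=> [h0 h] k; have [->//|] := eqVneq k ord0.
  by case: (unliftP ord0 k) => [l ->|-> /eqP//] _; rewrite tnthS; exact: h.
rewrite /product_measure1.
have Q0 : (0 <= tuple_lebesgue Q)%E.
  by rewrite /Q (IH (fun k => B (lift ord0 k)))//; apply: prode_ge0 => k _; exact: measure_ge0.
rewrite (eq_integral (fun x : measurableTypeR R => (\1_(B ord0) x)%:E * tuple_lebesgue Q)%E); last first.
  move=> x _; rewrite indicE; have [xB|xB] /= := boolP (x \in B ord0).
    by rewrite in_xsectionX// mul1e.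
  by rewrite mul0e notin_xsectionX// tuple_lebesgue0.
rewrite ge0_integralZr// ?integral_indic ?setIT//.
  exact: (mB ord0).
by apply/measurable_EFinP; apply: measurable_indic; exact: (mB ord0).
Qed.

Context (disp : measure_display) (T : measurableType disp) (P : probability T R).
Variables (d n : nat) (X : 'I_n -> {RV P >-> d.-tuple R}).
Hypothesis X_uniform : forall i, uniform_on_cube (X i).
Hypothesis X_indep : independent_RVs X.

Definition sample (w : T) : n.-tuple (d.-tuple R) := [tuple X i w | i < n].

Lemma measurable_sample : measurable_fun setT sample.
Proof.
apply/measurable_fun_tnthP => i.
by rewrite (_ : _ \o _ = X i)//; apply/funext => w /=; rewrite tnth_mktuple.
Qed.

Definition rectangle (B : 'I_n -> 'I_d -> set R) : set (n.-tuple (d.-tuple R)) :=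
  [set y | forall i k, B i k (tnth (tnth y i) k)].

Definition rectangles : set (set (n.-tuple (d.-tuple R))) :=
  [set A | exists2 B, (forall i k, measurable (B i k)) & A = rectangle B].

Lemma sample_rectangle B : (forall i k, measurable (B i k)) ->
  P (sample @^-1` rectangle B) =
  (\prod_(i < n) \prod_(k < d) lebesgue_measure (B i k `&` `[0%R, 1%R]))%E.
Proof.
move=> mB.
pose A i := [set y : d.-tuple R | forall k, B i k (tnth y k)].
have mA i : measurable (A i).
  have -> : A i = \big[setI/setT]_(k < d) ((@tnth _ R ^~ k) @^-1` B i k).
    rewrite -bigcap_seq/=; apply/seteqP; split=> y /= h k; first by move=> _; exact: h.
    by have := h k (mem_index_enum _).
  apply: bigsetI_measurable => k _; rewrite -[X in measurable X]setTI.
  exact: measurable_tnth.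
have := @X_indep (finset xpredT) A (fun i _ => mA i).
have -> : \bigcap_(i in [set` finset (fun _ : 'I_n => true)]) X i @^-1` A i = sample @^-1` rectangle B.
  apply/seteqP; split=> w /= h.
    by move=> i k; rewrite tnth_mktuple; apply: (h i); rewrite /= finset.inE.
  by move=> i _ k; have := h i k; rewrite tnth_mktuple.
move=> ->; rewrite (eq_bigl predT); last by move=> i; rewrite finset.inE.
apply: eq_bigr => i _.
have := X_uniform i (mA i); rewrite /distribution /pushforward => ->.
rewrite -tuple_lebesgue_rectangle; last by move=> k; exact: measurableI.
congr tuple_lebesgue; apply/seteqP; split=> y /=.
  by move=> [h1 h2] k; split; [exact: h1|rewrite in_itv/=; exact: h2].
by move=> h; split=> k; have [] := h k => // _; rewrite in_itv.
Qed.

Lemma measurable_rectangle B : (forall i k, measurable (B i k)) ->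
  measurable (rectangle B).
Proof.
move=> mB.
have -> : rectangle B = \big[setI/setT]_(i < n) \big[setI/setT]_(k < d)
    ((fun y : n.-tuple (d.-tuple R) => tnth (tnth y i) k) @^-1` B i k).
  rewrite -bigcap_seq/=; apply/seteqP; split=> y /= h i.
    by move=> _; rewrite -bigcap_seq/= => k _; exact: h.
  move=> k; have := h i (mem_index_enum _).
  by rewrite -bigcap_seq/= => /(_ k (mem_index_enum _)).
apply: bigsetI_measurable => i _; apply: bigsetI_measurable => k _.
rewrite -[X in measurable X]setTI.
apply: (measurableT_comp (measurable_tnth k) (measurable_tnth i)) => //.
Qed.

Lemma rectangles_setI : setI_closed rectangles.
Proof.
move=> _ _ [B mB ->] [C mC ->].
exists (fun i k => B i k `&` C i k); first by move=> i k; exact: measurableI.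
apply/seteqP; split=> y /=.
  by move=> [h1 h2] i k; split; [exact: h1|exact: h2].
by move=> h; split=> i k; have [] := h i k.
Qed.

Lemma measurable_rectanglesE : measurable = <<s rectangles >>.
Proof.
apply/seteqP; split; last first.
  apply: smallest_sub; first exact: sigma_algebra_measurable.
  by move=> _ [B mB ->]; exact: measurable_rectangle.
pose f (y : g_sigma_algebraType rectangles) : n.-tuple (d.-tuple R) := y.
suff mf : measurable_fun [set: g_sigma_algebraType rectangles] f.
  by move=> A mA; have := mf measurableT _ mA; rewrite setTI; exact.
apply/measurable_fun_tnthP => i; apply/measurable_fun_tnthP => k.
move=> _ C mC; rewrite setTI; apply: sub_sigma_algebra.
exists (fun i' k' => if (i' == i) && (k' == k) then C else setT).
  by move=> i' k'; case: ifP.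
apply/seteqP; split=> y /= h; last by have := h i k; rewrite !eqxx.
by move=> i' k'; case: ifP => // /andP[/eqP -> /eqP ->].
Qed.

Section Relocation.
Variables (m : nat) (m_gt0 : (0 < m)%N).
Local Notation cells := {ffun 'I_n -> {ffun 'I_d -> 'I_m}}.

Definition relocate_sample (z : cells) (y : n.-tuple (d.-tuple R)) :
    n.-tuple (d.-tuple R) :=
  [tuple [tuple relocate m (z i k) (tnth (tnth y i) k) | k < d] | i < n].

Lemma measurable_relocate_sample z : measurable_fun setT (relocate_sample z).
Proof.
apply/measurable_fun_tnthP => i; apply/measurable_fun_tnthP => k.
rewrite (_ : _ \o _ = (fun y => relocate m (z i k) (tnth (tnth y i) k))).
  apply: (measurableT_comp (measurable_relocate m (z i k))).
  exact: (measurableT_comp (measurable_tnth k) (measurable_tnth i)).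
by apply/funext => y /=; rewrite !tnth_mktuple.
Qed.

Lemma sum_prod_cells (f : 'I_n -> 'I_d -> 'I_m -> R) :
  \sum_(z : cells) \prod_(i < n) \prod_(k < d) f i k (z i k) =
  \prod_(i < n) \prod_(k < d) \sum_(j < m) f i k j.
Proof.
rewrite -(bigA_distr_bigA (fun i (c : {ffun 'I_d -> 'I_m}) => \prod_(k < d) f i k (c k))).
by apply: eq_bigr => i _; rewrite -(bigA_distr_bigA (f i)).
Qed.

Lemma relocation_average_rectangle B : (forall i k, measurable (B i k)) ->
  (\sum_(z : cells) P (sample @^-1` (relocate_sample z @^-1` rectangle B)) =
   #|{: cells}|%:R%:E * P (sample @^-1` rectangle B))%E.
Proof.
move=> mB.
pose q (C : set R) : R := fine (lebesgue_measure (C `&` `[0%R, 1%R])).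
have qE (C : set R) : measurable C -> lebesgue_measure (C `&` `[0%R, 1%R]) = (q C)%:E.
  move=> mC; rewrite fineK// ge0_fin_numE ?measure_ge0//.
  apply: (@le_lt_trans _ _ (lebesgue_measure (`[0%R, 1%R]%classic : set R))).
    by apply: le_measure; rewrite ?inE//; exact: measurableI.
  by rewrite lebesgue_measure_itv/= lte_fin ltr01 -EFinB ltry.
have mr i k (j : 'I_m) : measurable (relocate m j @^-1` B i k).
  by rewrite -[X in measurable X]setTI; exact: measurable_relocate.
have prE (C : 'I_n -> 'I_d -> set R) : (forall i k, measurable (C i k)) ->
    P (sample @^-1` rectangle C) = (\prod_(i < n) \prod_(k < d) q (C i k))%:E.
  move=> mC; rewrite sample_rectangle// -prodEFin; apply: eq_bigr => i _.
  by rewrite -prodEFin; apply: eq_bigr => k _; exact: qE.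
have -> : (\sum_(z : cells) P (sample @^-1` (relocate_sample z @^-1` rectangle B)) =
  (\sum_(z : cells) \prod_(i < n) \prod_(k < d) q (relocate m (z i k) @^-1` B i k))%:E)%E.
  rewrite -sumEFin; apply: eq_bigr => z _; rewrite -prE//.
  congr (P (sample @^-1` _)); apply/seteqP; split=> y /= h i k; have := h i k;
    by rewrite !tnth_mktuple.
rewrite prE// (sum_prod_cells (fun i k j => q (relocate m j @^-1` B i k))) -EFinM.
congr EFin.
have avg i k : \sum_(j < m) q (relocate m j @^-1` B i k) = m%:R * q (B i k).
  apply: EFin_inj; rewrite EFinM -qE// -lebesgue_relocate_average// -sumEFin.
  by apply: eq_bigr => j _; rewrite qE.
under eq_bigr do under eq_bigr do rewrite avg.
under eq_bigr do rewrite big_split/= prodr_const card_ord.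
rewrite big_split/= prodr_const card_ord; congr (_ * _).
by rewrite !card_ffun !card_ord natrX natrX.
Qed.

(** The rectangles generate the sigma-algebra and are closed under intersection, so it
    suffices to compare the two laws on them, where they factor into the averages
    of single coordinates. *)
Lemma relocation_average A : measurable A ->
  (\sum_(z : cells) P (sample @^-1` (relocate_sample z @^-1` A)) =
   #|{: cells}|%:R%:E * P (sample @^-1` A))%E.
Proof.
move=> mA.
have ms z : measurable_fun setT (relocate_sample z \o sample).
  exact: measurableT_comp (measurable_relocate_sample z) measurable_sample.
pose law z := measure_function_pushforward__canonical__measure_function_Measure P (ms z).
pose law0 := measure_function_pushforward__canonical__measure_function_Measure P measurable_sample.
pose mu1 := msum (fun k => law (nth [ffun=> [ffun=> Ordinal m_gt0]] (enum {: cells}) k)) #|{: cells}|.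
pose mu2 := msum (fun=> law0) #|{: cells}|.
have mu1E C : mu1 C = (\sum_(z : cells) P (sample @^-1` (relocate_sample z @^-1` C)))%E.
  rewrite /mu1 /msum -[RHS]big_enum/= [RHS](big_nth [ffun=> [ffun=> Ordinal m_gt0]]).
  by rewrite -cardE big_mkord.
have mu2E C : mu2 C = (#|{: cells}|%:R%:E * P (sample @^-1` C))%E.
  by rewrite /mu2 /msum sumr_const card_ord mule_natl.
rewrite -mu1E -mu2E.
apply: (measure_unique rectangles (fun=> setT)) => //.
- exact: measurable_rectanglesE.
- exact: rectangles_setI.
- by move=> _; exists (fun _ _ => setT) => //; apply/seteqP; split.
- by rewrite bigcup_const.
- move=> _ [B mB ->]; rewrite [LHS]mu1E [RHS]mu2E.
  exact: relocation_average_rectangle.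
- move=> _; rewrite [ltLHS]mu1E; apply/lte_sum_pinfty => z _.
  by rewrite !preimage_setT probability_setT ltry.
Qed.

(** By [relocation_average], the probability is the expectation, over the offsets of
    the sample, of the proportion of favourable choices of the cells. *)
Lemma probability_le_cell_proportion A (c : R) : measurable A ->
  (forall y, #|[set z : cells | relocate_sample z y \in A]%SET|%:R <=
     c * #|{: cells}|%:R) ->
  (P (sample @^-1` A) <= c%:E)%E.
Proof.
move=> mA hA.
have cells0 : (0 : R) < #|{: cells}|%:R.
  by rewrite ltr0n; apply/card_gt0P; exists [ffun=> [ffun=> Ordinal m_gt0]].
have mE z : measurable (sample @^-1` (relocate_sample z @^-1` A)).
  rewrite -[X in measurable X]setTI.
  by apply: (measurableT_comp (measurable_relocate_sample z) measurable_sample).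
suff : (#|{: cells}|%:R%:E * P (sample @^-1` A) <= #|{: cells}|%:R%:E * c%:E)%E.
  by rewrite lee_pmul2l// lte_fin.
rewrite -relocation_average//.
have -> : (\sum_(z : cells) P (sample @^-1` (relocate_sample z @^-1` A)) =
   \int[P]_w \sum_(z : cells) (\1_(sample @^-1` (relocate_sample z @^-1` A)) w)%:E)%E.
  rewrite ge0_integral_sum//=; last first.
    by move=> z; apply/measurable_EFinP; exact: measurable_indic.
  by apply: eq_bigr => z _; rewrite integral_indic// setIT.
apply: (@le_trans _ _ (\int[P]_w (c * #|{: cells}|%:R)%:E)%E); last first.
  by rewrite integral_cst//= probability_setT mule1 -EFinM lee_fin mulrC.
apply: ge0_le_integral => //.
- by move=> w _; apply: sume_ge0 => z _; rewrite lee_fin.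
- by apply: emeasurable_sum => z; apply/measurable_EFinP; exact: measurable_indic.
move=> w _; rewrite sumEFin lee_fin; apply: le_trans (hA (sample w)).
rewrite -sum1dep_card natr_sum [leRHS]big_mkcond/=; apply: ler_sum => z _.
rewrite indicE (_ : (w \in _) = (relocate_sample z (sample w) \in A)).
  by case: ifP.
by apply/idP/idP => /set_mem h; exact/mem_set.
Qed.

End Relocation.

End ProductLaw.

(** * Cells, blocks and grids *)

Section DistanceBounds.
Variables (R : realType) (d : nat).
Implicit Types x y : d.-tuple R.

Lemma coord_le_dist x y k : `|tnth x k - tnth y k| <= euclidean_dist x y.
Proof.
rewrite -sqrtr_sqr ler_wsqrtr// (bigD1 k)//= lerDl.
by apply: sumr_ge0 => l _; exact: sqr_ge0.
Qed.

Lemma dist_le_sum_coords x y :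
  euclidean_dist x y <= \sum_(k < d) `|tnth x k - tnth y k|.
Proof.
have [h1 h2] : \sum_(k < d) (tnth x k - tnth y k) ^+ 2 <=
    (\sum_(k < d) `|tnth x k - tnth y k|) ^+ 2 /\
    0 <= \sum_(k < d) `|tnth x k - tnth y k|.
  elim/big_rec2: _ => [|k a b _ [IH a0]]; first by rewrite expr0n.
  split; last by rewrite addr_ge0.
  rewrite -(real_normK (num_real (_ - _))).
  move: (normr_ge0 (tnth x k - tnth y k)); set c := `|_| => c0; nra.
by rewrite -(ler_sqr (sqrtr_ge0 _) h2) sqr_sqrtr//; apply: sumr_ge0 => k _; exact: sqr_ge0.
Qed.

End DistanceBounds.

Section Cells.
Variables (R : realType) (d g H r B q : nat).
Hypothesis d_ge2 : (2 <= d)%N.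
Hypothesis g_gt0 : (0 < g)%N.
Hypothesis H_gt0 : (0 < H)%N.
Hypothesis block_wide : (2 * r + H * g < B)%N.

Local Notation m := (q * B)%N.
Local Notation block := {ffun 'I_d -> 'I_q}.
Local Notation cell := {ffun 'I_d -> 'I_m}.

Lemma block_side_gt0 : (0 < B)%N.
Proof. exact: leq_ltn_trans (leq0n _) block_wide. Qed.

Lemma block_index_lt (c : 'I_m) : (c %/ B < q)%N.
Proof. by rewrite ltn_divLR ?ltn_ord// block_side_gt0. Qed.

Definition block_of (c : cell) : block := [ffun k => Ordinal (block_index_lt (c k))].

Lemma cell_index_lt (a : 'I_q) (o : 'I_B) : (a * B + o < m)%N.
Proof. by have := ltn_ord a; have := ltn_ord o; clear; nia. Qed.

Definition cell_at (Q : block) (o : 'I_d -> 'I_B) : cell :=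
  [ffun k => Ordinal (cell_index_lt (Q k) (o k))].

Lemma block_of_cell_at Q o : block_of (cell_at Q o) = Q.
Proof.
apply/ffunP => k; apply: val_inj; rewrite !ffunE /=.
have ok := ltn_ord (o k).
by rewrite divnMDl ?divn_small ?addn0//; lia.
Qed.

(** The [g] x [g] grid of step [H] in the plane of the first two coordinates, indexed by
    the two base [g] digits of [t]; the successors keep it off the central cell. *)
Definition grid_shift (t k : nat) : nat :=
  match k with
  | 0 => H * ((t %/ g) %% g).+1
  | 1 => H * (t %% g).+1
  | _ => 0
  end.

Lemma grid_shift_le t k : (grid_shift t k <= H * g)%N.
Proof.
by case: k => [|[|k]]//=; rewrite leq_mul2l; apply/orP; right; exact: ltn_pmod.
Qed.

Lemma grid_offset_lt t k : (r + grid_shift t k < B)%N.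
Proof. by have := grid_shift_le t k; have := block_wide; clear; lia. Qed.

Lemma center_offset_lt : (r < B)%N.
Proof. by have := block_wide; clear; lia. Qed.

Definition center_cell (Q : block) : cell :=
  cell_at Q (fun=> Ordinal center_offset_lt).

Definition grid_cell (Q : block) (t : nat) : cell :=
  cell_at Q (fun k => Ordinal (grid_offset_lt t k)).

Lemma grid_cell_neq_center Q t : grid_cell Q t != center_cell Q.
Proof.
have d0 : (0 < d)%N by lia.
apply/eqP => /ffunP /(_ (Ordinal d0)); rewrite !ffunE => /(congr1 val) /=.
have : (0 < H * ((t %/ g) %% g).+1)%N by rewrite muln_gt0 H_gt0.
by lia.
Qed.

Lemma card_block_cells Q : #|[set c : cell | block_of c == Q]| = (B ^ d)%N.
Proof.
have B0 : (0 < B)%N by lia.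
have -> : (B ^ d = #|{: {ffun 'I_d -> 'I_B}}|)%N by rewrite card_ffun !card_ord.
have inj : injective (fun o : {ffun 'I_d -> 'I_B} => cell_at Q o).
  move=> o o' /ffunP e; apply/ffunP => k; apply: val_inj.
  by have := congr1 val (e k); rewrite !ffunE /=; lia.
rewrite -(card_imset _ inj); apply: eq_card => c; rewrite inE.
apply/eqP/imsetP => [e|]; last by case=> o _ ->; exact: block_of_cell_at.
exists [ffun k => Ordinal (ltn_pmod (c k) B0)] => //.
by apply/ffunP => k; apply: val_inj; rewrite -e !ffunE /= -divn_eq.
Qed.

Section Points.
Variables (n : nat) (y : n.-tuple (d.-tuple R)).
Local Notation config := {ffun 'I_n -> cell}.
Local Notation point z i := (tnth (relocate_sample z y) i).

Hypothesis q_gt0 : (0 < q)%N.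
Let u : R := m%:R^-1.

Let u_gt0 : 0 < u.
Proof. by rewrite invr_gt0 ltr0n muln_gt0 q_gt0; lia. Qed.

Lemma point_cell (z : config) i k :
  (z i k)%:R * u <= tnth (point z i) k < (z i k).+1%:R * u.
Proof.
rewrite !tnth_mktuple /relocate -/u; set x := tnth _ k.
have /andP[f1 f2] := floor_itv (m%:R * x).
rewrite intrD1 in f2.
by rewrite ler_pM2r// ltr_pM2r// -natr1 lerDl ltrD2l subr_ge0 f1 ltrBlDl.
Qed.

Lemma dist_ge_coord (z z' : config) i j k w : (z i k + w < z' j k)%N ->
  w%:R * u <= euclidean_dist (point z i) (point z' j).
Proof.
move=> h; apply: le_trans (coord_le_dist _ _ k); rewrite distrC.
apply: le_trans (ler_norm _).
have /andP[_ h1] := point_cell z i k; have /andP[h2 _] := point_cell z' j k.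
have h3 : ((z i k).+1%:R + w%:R) * u <= (z' j k)%:R * u.
  by rewrite ler_pM2r// -natrD ler_nat; lia.
rewrite lerBrDr; apply: le_trans h2; apply: le_trans h3.
by rewrite mulrDl addrC lerD2r ltW.
Qed.

Lemma dist_le_coords (z z' : config) i j (w : 'I_d -> nat) :
  (forall k, (z i k <= z' j k + w k)%N) -> (forall k, (z' j k <= z i k + w k)%N) ->
  euclidean_dist (point z i) (point z' j) <= (\sum_(k < d) (w k).+1)%:R * u.
Proof.
move=> h1 h2; apply: le_trans (dist_le_sum_coords _ _) _.
rewrite natr_sum mulr_suml; apply: ler_sum => k _.
have /andP[a1 a2] := point_cell z i k; have /andP[b1 b2] := point_cell z' j k.
have c1 : (z i k).+1%:R * u <= (z' j k)%:R * u + (w k).+1%:R * u.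
  by rewrite -mulrDl ler_pM2r// -natrD ler_nat addnS ltnS.
have c2 : (z' j k).+1%:R * u <= (z i k)%:R * u + (w k).+1%:R * u.
  by rewrite -mulrDl ler_pM2r// -natrD ler_nat addnS ltnS.
rewrite ler_norml; apply/andP; split.
  rewrite lerNl opprB lerBlDr addrC; apply: le_trans (ltW b2) _.
  by apply: le_trans c2 _; rewrite lerD2r.
rewrite lerBlDr addrC; apply: le_trans (ltW a2) _.
by apply: le_trans c1 _; rewrite lerD2r.
Qed.

Definition spread_width (k : nat) : nat := if (k < 2)%N then (H * g)%N else 0%N.

Lemma grid_shift_width t k : (grid_shift t k <= spread_width k)%N.
Proof.
by rewrite /spread_width; case: ltnP => hk; [exact: grid_shift_le|case: k hk => [|[|k]]].
Qed.

Lemma sum_spread_width : (\sum_(k < d) (spread_width k).+1 = 2 * (H * g) + d)%N.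
Proof.
rewrite -(subnKC d_ge2) !big_ord_recl /= /spread_width /= /bump /=.
rewrite (eq_bigr (fun=> 1%N)) // sum_nat_const card_ord; lia.
Qed.

Lemma grid_cellE Q t k : grid_cell Q t k = (Q k * B + (r + grid_shift t k))%N :> nat.
Proof. by rewrite ffunE. Qed.

Lemma center_cellE Q k : center_cell Q k = (Q k * B + r)%N :> nat.
Proof. by rewrite ffunE. Qed.

(** Distinct ranks below [g ^ 2] have distinct base [g] digits. *)
Lemma grid_cells_apart (z : config) Q i j t t' :
  (t < g ^ 2)%N -> (t' < g ^ 2)%N -> t != t' ->
  z i = grid_cell Q t -> z j = grid_cell Q t' ->
  (H - 1)%:R * u <= euclidean_dist (point z i) (point z j).
Proof.
have d0 : (0 < d)%N by lia.
have main k (a b : nat) i1 i2 t1 t2 : grid_shift t1 k = (H * a.+1)%N ->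
    grid_shift t2 k = (H * b.+1)%N -> a != b ->
    z i1 = grid_cell Q t1 -> z i2 = grid_cell Q t2 -> (k < d)%N ->
    (H - 1)%:R * u <= euclidean_dist (point z i1) (point z i2).
  move=> + + + + + kd; wlog ab : a b i1 i2 t1 t2 / (a < b)%N => [th|].
    move=> h1 h2 ab z1 z2; move: (ab); rewrite neq_ltn => /orP[ltab|ltba].
      exact: (th a b _ _ t1 t2).
    by rewrite euclidean_distC; apply: (th b a _ _ t2 t1) => //; rewrite eq_sym.
  move=> h1 h2 _ z1 z2; apply: (@dist_ge_coord _ _ _ _ (Ordinal kd)).
  by rewrite z1 z2 !grid_cellE /= h1 h2; nia.
move=> ht ht' tt' zi zj.
have small s : (s < g ^ 2)%N -> (s %/ g %% g = s %/ g)%N.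
  by move=> hs; rewrite modn_small// ltn_divLR// mulnn.
have [e|ne] := eqVneq (t %/ g)%N (t' %/ g)%N.
  have ne : (t %% g != t' %% g)%N.
    by apply: contra tt' => /eqP e'; rewrite (divn_eq t g) (divn_eq t' g) e e'.
  exact: (main 1%N _ _ _ _ t t' _ _ ne).
by apply: (main 0%N _ _ _ _ t t' _ _ ne) => //=; rewrite small.
Qed.

Lemma rank_lt (z : config) Q i : i \in occupants block_of z Q ->
  (rank_in_block block_of z i < #|occupants block_of z Q|)%N.
Proof.
move=> iQ; apply: proper_card; apply/properP; split.
  apply/fintype.subsetP => j; rewrite !inE => /andP[+ _].
  by move: iQ; rewrite inE => /eqP ->.
by exists i => //; rewrite !inE ltnn andbF.
Qed.

Lemma rank_neq (z : config) Q i j : i \in occupants block_of z Q ->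
  j \in occupants block_of z Q -> i != j ->
  rank_in_block block_of z i != rank_in_block block_of z j.
Proof.
wlog ij : i j / (i < j)%N => [th iQ jQ ne|iQ jQ _].
  case: (ltngtP i j) => [h|h|/ord_inj e]; first exact: th.
    by rewrite eq_sym; apply: th => //; rewrite eq_sym.
  by rewrite e eqxx in ne.
rewrite ltn_eqF//; apply: proper_card; apply/properP; split.
  apply/fintype.subsetP => l; rewrite !inE => /andP[h1 h2].
  move: iQ jQ; rewrite !inE => /eqP e1 /eqP e2.
  by rewrite e2 -e1 h1 (ltn_trans h2).
move: iQ jQ; rewrite !inE => /eqP e1 /eqP e2.
by exists i; rewrite !inE ?ij ?ltnn ?andbF// e1 e2 eqxx.
Qed.

(** In units of the cell side, distinct points of the spread cluster are at least
    [H - 1] apart, points of the collapsed one at most [d], a point moves by at most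
    [2 * (H * g) + d], which also bounds the diameter, and points of other blocks
    are at least [r] away. *)
Lemma tour_collapse (z z' : config) Q :
  (4 * (2 * (H * g) + d) < (g ^ 2 - 2) * (H - 1 - d))%N ->
  (12 * (2 * (H * g) + d) < r)%N ->
  (forall i, block_of (z' i) = block_of (z i)) ->
  (forall i, block_of (z i) != Q -> z' i = z i) ->
  collapsed block_of center_cell (g ^ 2) z Q ->
  spread block_of grid_cell (g ^ 2) z' Q ->
  optimal_tour_length (fun i => point z i) + u <=
  optimal_tour_length (fun i => point z' i).
Proof.
move=> gain iso sameblk same /andP[_ /forall_inP hc] /andP[/eqP cJ /forall_inP hs].
set J := occupants block_of z' Q in cJ hs.
have JE i : (i \in J) = (block_of (z i) == Q) by rewrite inE sameblk.
have zi i : i \in J -> z i = center_cell Q.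
  by rewrite JE => h; apply/eqP/hc; rewrite inE.
have zi' i : i \in J -> z' i = grid_cell Q (rank_in_block block_of z' i).
  by move=> h; apply/eqP/hs.
have far i j : i \in J -> j \notin J -> r%:R * u <= euclidean_dist (point z' i) (point z' j).
  move=> iJ jJ; have : block_of (z' j) != Q by move: jJ; rewrite inE.
  move=> nQ; have [k nk] : exists k, block_of (z' j) k != Q k.
    apply/existsP; apply: contraR nQ; rewrite negb_exists => /forallP h.
    by apply/eqP/ffunP => k; apply/eqP; have := h k; rewrite negbK.
  have := grid_shift_le (rank_in_block block_of z' i) k.
  have := grid_cellE Q (rank_in_block block_of z' i) k; rewrite -zi'// => e sh.
  have := ltn_ord (block_of (z' j) k).
  have B0 : (0 < B)%N by lia.
  move: nk; rewrite ffunE -val_eqE /= neq_ltn => /orP[lt|gt] _.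
    rewrite euclidean_distC; apply: (@dist_ge_coord _ _ _ _ k).
    by move: lt; rewrite ltn_divLR//; lia.
  apply: (@dist_ge_coord _ _ _ _ k).
  by move: gt; rewrite leq_divRL// mulSn; lia.
have width i j t t' (a b : config) : a i = grid_cell Q t ->
    b j = grid_cell Q t' \/ b j = center_cell Q ->
    euclidean_dist (point a i) (point b j) <= (2 * (H * g) + d)%:R * u.
  move=> ea eb; rewrite -sum_spread_width; apply: dist_le_coords => k;
    have := grid_shift_width t k; have := grid_shift_width t' k;
    rewrite ea grid_cellE; case: eb => ->; rewrite ?grid_cellE ?center_cellE; lia.
have := @collapse_gain R d n (fun i => point z' i) (fun i => point z i) J (g ^ 2)
  ((H - 1)%:R * u) (d%:R * u) ((2 * (H * g) + d)%:R * u) (r%:R * u)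
  ((2 * (H * g) + d)%:R * u) _ cJ.
move=> cg; apply: le_trans (cg _ _ _ _ _ _ _ _ _) => {cg}.
- rewrite lerD2l.
  have g2 : (2 <= g ^ 2)%N by nia.
  have dH : (d <= H - 1)%N by nia.
  rewrite -(natrB _ g2) -mulrBl -(natrB _ dH) mulrA mulrA -mulrBl -natrM.
  by rewrite -natrM ler_peMl// ?(ltW u_gt0)// lerBrDr nat1r ler_nat.
- by nia.
- by move=> i; rewrite JE => h; rewrite !tnth_mktuple same.
- move=> i j iJ jJ ij.
  apply: (grid_cells_apart _ _ (rank_neq iJ jJ ij) (zi' _ iJ) (zi' _ jJ));
    rewrite -cJ; exact: rank_lt.
- move=> i j iJ jJ.
  have -> : d%:R = (\sum_(k < d) 1)%:R :> R by rewrite sum_nat_const card_ord muln1.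
  by apply: (@dist_le_coords _ _ _ _ (fun=> 0%N)) => k; rewrite !zi// addn0.
- by move=> i iJ; apply: (width _ _ _ 0%N); [exact: zi'|right; exact: zi].
- by move=> i j iJ jJ; apply: width; [exact: zi'|left; exact: zi'].
- exact: far.
- by rewrite mulrA ltr_pM2r// -natrM ltr_nat.
- by rewrite ler_pM2r// ler_nat; nia.
Qed.

End Points.
End Cells.

(** * Counting good blocks *)

Section GoodBlockCount.
Implicit Types (n K N V e j : nat).

Lemma bernoulli_nat N j : (N ^ j * (N - j) <= N * N.-1 ^ j)%N.
Proof.
elim: j => [|j IH]; first by rewrite subn0 expn0 mul1n muln1.
have [Nj|jN] := leqP N j.
  by rewrite (_ : N - j.+1 = 0)%N ?muln0; lia.
rewrite [in leqRHS]expnSr mulnA; apply: leq_trans (leq_mul IH (leqnn _)).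
rewrite expnSr -!mulnA leq_mul2l; apply/orP; right.
by nia.
Qed.

(** By Bernoulli's inequality, each half of the exponent contributes a factor of at
    least 1/4 to [(1 - 1/N) ^ j]. *)
Lemma avoid_block N j : (2 <= N)%N -> (j <= N)%N -> (N ^ j <= 16 * N.-1 ^ j)%N.
Proof.
move=> N2 jN.
have half l : (2 * l <= N.+1)%N -> (N ^ l <= 4 * N.-1 ^ l)%N.
  move=> hl; have b := bernoulli_nat N l.
  have N0 : (0 < N)%N by lia.
  have h : (N <= 4 * (N - l))%N by lia.
  rewrite -(leq_pmul2r N0).
  apply: (@leq_trans (N ^ l * (4 * (N - l)))%N); first exact: leq_mul.
  by rewrite mulnCA -mulnA leq_mul2l /= [(_ * N)%N]mulnC.
rewrite -(odd_double_half j) -addnn addnA !expnD.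
have h1 : (N ^ (odd j + j./2) <= 4 * N.-1 ^ (odd j + j./2))%N by apply: half; lia.
have h2 : (N ^ j./2 <= 4 * N.-1 ^ j./2)%N by apply: half; lia.
rewrite -!expnD.
rewrite !(expnD _ (odd j + j./2)).
by apply: leq_trans (leq_mul h1 h2) _; rewrite mulnACA.
Qed.

Lemma ffact_lower n K : ((n - K) ^ K <= n ^_ K)%N.
Proof.
elim: K => [|K IH]; first by rewrite ffactn0.
rewrite ffactnSr expnSr; apply: leq_mul; last by lia.
by apply: leq_trans IH; case: K => // K; rewrite leq_exp2r //; lia.
Qed.

(** The inverse of a lower bound for the probability that a given block is collapsed:
    16 accounts for the points that avoid the block, the next factor for
    ['C(n, K) / N ^ K], and [V ^ K] for the cells of the points in the block. *)
Definition block_cost K V e : nat := 16 * (K`! * (2 ^ e.+1) ^ K) * V ^ K.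

Lemma many_collapsed n K N V e : (2 <= N)%N -> (0 < K)%N -> (2 * K <= n)%N ->
  (n <= N)%N -> (N <= 2 ^ e * n)%N ->
  ((N * V) ^ n <= block_cost K V e * ('C(n, K) * (N * V - V) ^ (n - K)))%N.
Proof.
move=> N2 K0 Kn nN Nn.
have hC : (N ^ K <= K`! * (2 ^ e.+1) ^ K * 'C(n, K))%N.
  rewrite mulnAC [(K`! * _)%N]mulnC bin_ffact.
  apply: (@leq_trans ((n - K) ^ K * (2 ^ e.+1) ^ K)%N).
    rewrite -expnMn leq_exp2r// expnS.
    have : (n <= 2 * (n - K))%N by lia.
    by move: Nn; set x := (2 ^ e)%N; nia.
  by rewrite leq_mul2r ffact_lower orbT.
have hA : (N ^ (n - K) <= 16 * N.-1 ^ (n - K))%N by apply: avoid_block => //; lia.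
have -> : (N * V - V = N.-1 * V)%N by rewrite -{2}[V]mul1n -mulnBl subn1.
have {1}-> : n = (K + (n - K))%N by lia.
rewrite !expnMn expnD.
apply: (@leq_trans (K`! * (2 ^ e.+1) ^ K * 'C(n, K) * (16 * N.-1 ^ (n - K)) * V ^ (K + (n - K)))%N).
  by rewrite leq_mul2r leq_mul ?orbT.
rewrite /block_cost expnD.
set x := (_ `!)%N; set y := ((2 ^ _) ^ _)%N; set a := (V ^ K)%N; set b := (V ^ (n - K))%N.
set c := (N.-1 ^ _)%N; set t := 'C(_, _).
by apply/eq_leq; ring.
Qed.

End GoodBlockCount.

(** * The bound for one sample size *)

Section OneSampleSize.
Local Open Scope classical_set_scope.
Variable R : realType.

Lemma measurable_optimal_tour_length d n :
  measurable_fun setT (fun y : n.-tuple (d.-tuple R) => optimal_tour_length (tnth y)).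
Proof.
have mc i : (fun y : n.-tuple (d.-tuple R) => tnth y i) \in mfun.
  by rewrite inE; exact: measurable_tnth.
pose y0 : n.-tuple (d.-tuple R) := nseq_tuple n (nseq_tuple d 0).
exact: (@measurable_optimal_tour _ _ R (dirac y0) d n (fun i => mfun_Sub (mc i))).
Qed.

(** Collapsed blocks alone are numerous enough on average. *)
Lemma good_blocks_lower (n : nat) (Cell Block : finType) (blk : Cell -> Block)
    (ctr : Block -> Cell) (spr : Block -> nat -> Cell) (K V e : nat) :
  (forall Q, blk (ctr Q) = Q) ->
  (forall Q, #|[set c | blk c == Q]%SET| = V) -> #|Cell| = (#|Block| * V)%N ->
  (2 <= #|Block|)%N -> (0 < K)%N -> (2 * K <= n)%N -> (n <= #|Block|)%N ->
  (#|Block| <= 2 ^ e * n)%N ->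
  (#|Block| * #|{: {ffun 'I_n -> Cell}}| <= block_cost K V e *
   \sum_(z : {ffun 'I_n -> Cell}) #|good_blocks blk ctr spr K z|)%N.
Proof.
move=> blk_ctr hV hC N2 K0 Kn nN Nn.
apply: (@leq_trans (block_cost K V e *
  \sum_(z : {ffun 'I_n -> Cell}) #|[set Q | collapsed blk ctr K z Q]%SET|)%N); last first.
  rewrite leq_mul2l; apply/orP; right; apply: leq_sum => z _.
  by apply/subset_leq_card/fintype.subsetP => Q; rewrite !finset.inE => ->.
have -> : (\sum_(z : {ffun 'I_n -> Cell}) #|[set Q | collapsed blk ctr K z Q]%SET| =
    #|Block| * ('C(n, K) * (#|Block| * V - V) ^ (n - K)))%N.
  under eq_bigr do rewrite -sum1dep_card big_mkcond/=.
  rewrite exchange_big/=.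
  transitivity (\sum_(Q : Block) 'C(n, K) * (#|Block| * V - V) ^ (n - K))%N; last first.
    by rewrite sum_nat_const.
  by apply: eq_bigr => Q _; rewrite -big_mkcond sum1dep_card card_collapsed// hV hC.
rewrite mulnCA leq_mul2l card_ffun card_ord hC.
by apply/orP; right; exact: many_collapsed.
Qed.

(** Reverse Markov inequality: as [s] is at most [N], an average of at least [N / X]
    forces [s] to be at least [N / (2 * X)] on a proportion of at least
    [1 / (2 * X)] of [Z]. *)
Lemma many_large (Z : finType) (s : Z -> nat) (N X k : nat) :
  (0 < N)%N -> (forall z, s z <= N)%N -> (N * #|Z| <= X * \sum_z s z)%N ->
  (2 * X * k <= N)%N -> (#|Z| <= 2 * X * #|[set z | (k <= s z)%N]%SET|)%N.
Proof.
move=> N0 sN hS hk.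
have : (\sum_z s z <= N * #|[set z | (k <= s z)%N]%SET| + k * #|Z|)%N.
  have -> : (N * #|[set z | (k <= s z)%N]%SET| = \sum_z N * (k <= s z))%N.
    by rewrite -big_distrr/= -sum1dep_card big_mkcond/=;
      congr (_ * _)%N; apply: eq_bigr => z _; case: ifP.
  have -> : (k * #|Z| = \sum_(z : Z) k)%N by rewrite sum_nat_const mulnC.
  rewrite -big_split/=; apply: leq_sum => z _; have := sN z.
  by case: (leqP k (s z)) => h hs; rewrite ?muln1 ?muln0 ?add0n ?(ltnW h)// (leq_trans hs)// leq_addr.
set S := \sum_z _ in hS *; set c := #|finset _|; set M := #|Z| in hS * => h.
rewrite -(leq_pmul2l N0).
have h1 : (X * S <= X * (N * c + k * M))%N by rewrite leq_mul2l h orbT.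
have h2 : (2 * X * k * M <= N * M)%N by rewrite leq_mul2r hk orbT.
by nia.
Qed.

(** Toggling at least [16 * T ^ 2] good blocks spreads the length over more than [T]
    cell sides. With [Y] the block cost, a proportion of at least [1 / (2 * Y)] of the
    assignments has that many good blocks, and an eighth of it is lost. *)
Lemma tour_interval_probability (d g H r B q n T : nat)
    (disp : measure_display) (Omega : measurableType disp)
    (P : probability Omega R) (X : 'I_n -> {RV P >-> d.-tuple R}) (a b : R) :
  (2 <= d)%N -> (0 < g)%N -> (0 < H)%N -> (2 * r + H * g < B)%N ->
  (4 * (2 * (H * g) + d) < (g ^ 2 - 2) * (H - 1 - d))%N ->
  (12 * (2 * (H * g) + d) < r)%N ->
  (0 < q)%N -> (n <= q ^ d)%N -> (q ^ d <= 2 ^ d * n)%N -> (2 * g ^ 2 <= n)%N ->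
  (2 * block_cost (g ^ 2) (B ^ d) d * (16 * T ^ 2) <= n)%N ->
  b - a < T%:R / (q * B)%:R ->
  (forall i, uniform_on_cube (X i)) -> independent_RVs X ->
  (P [set w | (a <= optimal_tour_RV X w <= b)%R] <=
   (1 - (16 * (block_cost (g ^ 2) (B ^ d) d)%:R)^-1)%:E)%E.
Proof.
move=> d2 g0 H0 wide gain iso q0 nq qn gn hT hab unif indep.
set Y := block_cost _ _ _ in hT *.
have B0 : (0 < B)%N by lia.
have K0 : (0 < g ^ 2)%N by rewrite expn_gt0 g0.
have Y0 : (0 < Y)%N by rewrite !muln_gt0 fact_gt0 !expn_gt0 B0.
pose A := (fun y : n.-tuple (d.-tuple R) => optimal_tour_length (tnth y)) @^-1` `[a, b].
have mA : measurable A.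
  rewrite -[A]setTI; apply: measurable_optimal_tour_length => //.
have -> : [set w | a <= optimal_tour_RV X w <= b] = sample X @^-1` A.
  apply/funext => w; rewrite /A /preimage /= in_itv/=.
  rewrite (_ : tnth (sample X w) = (fun i => X i w)) //.
  by apply/funext => i; rewrite tnth_mktuple.
have m0 : (0 < q * B)%N by rewrite muln_gt0 q0.
apply: (probability_le_cell_proportion unif indep m0 mA) => y.
pose F (z : {ffun 'I_n -> {ffun 'I_d -> 'I_(q * B)}}) : R :=
  optimal_tour_length (tnth (relocate_sample z y)).
have hab' : b - a < T%:R * (q * B)%:R^-1 by [].
pose blk := @block_of d g H r B q wide.
pose ctr := @center_cell d g H r B q wide.
pose spr := @grid_cell d g H r B q g0 wide.
have blk_ctr Q : blk (ctr Q) = Q by exact: block_of_cell_at.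
have blk_spr Q t : blk (spr Q t) = Q by exact: block_of_cell_at.
have spr_ctr Q t : spr Q t != ctr Q by exact: grid_cell_neq_center.
have := config_anticoncentration blk_ctr blk_spr spr_ctr K0
  (F := F) (fun z z' Q => @tour_collapse R d g H r B q d2 g0 H0 wide n y q0 z z' Q gain iso)
  hab'.
have cB : #|{: {ffun 'I_d -> 'I_q}}| = (q ^ d)%N by rewrite card_ffun !card_ord.
have cC : #|{: {ffun 'I_d -> 'I_(q * B)}}| = (#|{: {ffun 'I_d -> 'I_q}}| * B ^ d)%N.
  by rewrite cB card_ffun !card_ord expnMn.
have large : (#|{: {ffun 'I_n -> {ffun 'I_d -> 'I_(q * B)}}}| <= 2 * Y *
    #|[set z : {ffun 'I_n -> {ffun 'I_d -> 'I_(q * B)}} |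
        (16 * T ^ 2 <= #|good_blocks blk ctr spr (g ^ 2) z|)%N]%SET|)%N.
  have N0 : (0 < #|{: {ffun 'I_d -> 'I_q}}|)%N by rewrite cB expn_gt0 q0.
  apply: (@many_large {ffun 'I_n -> {ffun 'I_d -> 'I_(q * B)}}
    (fun z => #|good_blocks blk ctr spr (g ^ 2) z|) #|{: {ffun 'I_d -> 'I_q}}| Y
    (16 * T ^ 2) N0).
  - by move=> z; exact: max_card.
  - apply: good_blocks_lower => //; rewrite ?cB//; last by lia.
    by move=> Q; exact: card_block_cells.
  - by rewrite cB; exact: leq_trans hT nq.
move: large; set M := #|{: _}|; set l := #|finset _|; set f := #|finset _|; set f' := #|finset _|.
have -> : f' = f.
  apply: eq_card => z; rewrite !finset.inE.
  by apply/idP/idP => [/set_mem|h]; [|apply/mem_set]; rewrite /A /= in_itv.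
move=> h1 h2; have {h1 h2}h : (16 * Y * f + M <= 16 * Y * M)%N by nia.
have Y0' : (0 : R) < 16 * Y%:R by rewrite mulr_gt0// ltr0n.
rewrite mulrBl mul1r lerBrDr -(ler_pM2l Y0') mulrDr mulrA divff ?gt_eqF// mul1r.
by rewrite -!natrM -natrD ler_nat.
Qed.

End OneSampleSize.

(** * Asymptotics *)

Lemma block_scale (d n : nat) : (0 < d)%N -> (2 <= n)%N -> exists q : nat,
  [/\ (0 < q)%N, (n <= q ^ d)%N & (q ^ d <= 2 ^ d * n)%N].
Proof.
move=> d0 n2; have ex : exists q, (n <= q ^ d)%N.
  by exists n; rewrite -{1}[n]expn1 leq_pexp2l//; lia.
have [q hq qmin] := ex_minnP ex; exists q.
have q2 : (2 <= q)%N.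
  rewrite ltnNge; apply/negP => q1; have : (q ^ d <= 1 ^ d)%N by rewrite leq_exp2r.
  by rewrite exp1n; lia.
split=> //; first by lia.
have h : (q.-1 ^ d < n)%N by rewrite ltnNge; apply/negP => /qmin; lia.
apply: (@leq_trans ((2 * q.-1) ^ d)%N); first by rewrite leq_exp2r//; lia.
by rewrite expnMn leq_mul2l ltnW ?orbT.
Qed.

Lemma sqrt_scale (Y n : nat) : (0 < Y)%N -> (Y <= n)%N -> exists T : nat,
  [/\ (0 < T)%N, (Y * T ^ 2 <= n)%N & (n < (2 * Y * T) ^ 2)%N].
Proof.
move=> Y0 Yn; pose Q T := (Y * T ^ 2 <= n)%N.
have ex : exists T, Q T by exists 1%N; rewrite /Q muln1.
have bd T : Q T -> (T <= n)%N by rewrite /Q; nia.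
have [T hT Tmax] := ex_maxnP ex bd; exists T.
have T0 : (0 < T)%N by apply: Tmax; rewrite /Q muln1.
split=> //; have : ~~ Q T.+1 by apply/negP => /Tmax; rewrite ltnn.
by rewrite /Q -ltnNge; nia.
Qed.

(** The cell side is of order [1 / q], so that [sqrt n] cell sides are of order
    [n ^ (1/2 - 1/d)]. *)
Lemma powR_scale (R : realType) (d n q : nat) : (2 <= d)%N -> (0 < n)%N ->
  (q ^ d <= 2 ^ d * n)%N ->
  n%:R `^ ((d%:R - 2) / (2 * d%:R)) * q%:R <= 2 * Num.sqrt n%:R :> R.
Proof.
move=> d2 n0 hq.
have d0 : (0 : R) < d%:R by rewrite ltr0n; lia.
have n0' : (0 : R) < n%:R by rewrite ltr0n.
have hq' : q%:R <= 2 * n%:R `^ (d%:R^-1) :> R.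
  have d1 : (0 < d)%N by lia.
  rewrite -(@ler_pXn2r _ d)// ?nnegrE ?mulr_ge0 ?powR_ge0//.
  rewrite exprMn -[(_ `^ _) ^+ d]powR_mulrn ?powR_ge0// -powRrM mulVf ?gt_eqF//.
  by rewrite powRr1 ?ler0n// -!natrX -natrM ler_nat.
apply: (le_trans (ler_wpM2l (powR_ge0 _ _) hq')).
rewrite mulrCA -powRD; last by apply/implyP => _; rewrite gt_eqF.
rewrite (_ : _ / _ + _ = 2^-1); last by field; rewrite gt_eqF.
by rewrite powR12_sqrt// ltW.
Qed.

(** The internal edges, about [g ^ 2] of length about [H], beat the diameter of the
    grid, which is of order [H * g], as soon as [g] is large; the step [H] has to
    exceed the diameter [d] of a cell. *)
Lemma grid_parameters (d : nat) : exists g H r B : nat,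
  [/\ (1 < g)%N, (0 < H)%N, (2 * r + H * g < B)%N,
      (4 * (2 * (H * g) + d) < (g ^ 2 - 2) * (H - 1 - d))%N &
      (12 * (2 * (H * g) + d) < r)%N].
Proof.
exists 18%N, (2 * d + 2)%N, (12 * (2 * ((2 * d + 2) * 18) + d)).+1,
  (2 * (12 * (2 * ((2 * d + 2) * 18) + d)).+1 + (2 * d + 2) * 18).+1.
by split; lia.
Qed.

Theorem theorem2p3 (R : realType) (d : nat) (hd : (2 <= d)%N)
  (disp : nat -> measure_display) (T : forall n : nat, measurableType (disp n))
  (P : forall n : nat, probability (T n) R)
  (X : forall n : nat, 'I_n -> {RV (P n) >-> d.-tuple R})
  (X_uniform : forall (n : nat) (i : 'I_n), uniform_on_cube (X n i))
  (X_indep : forall n : nat, independent_RVs (X n)) :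
  fluctuations_at_least (fun n => optimal_tour_RV (X n))
    (fun n => n%:R `^ ((d%:R - 2) / (2 * d%:R))).
Proof.
have [g [H [r [B [g1 H0 wide gain iso]]]]] := grid_parameters d.
have g0 : (0 < g)%N by lia.
set K := (g ^ 2)%N; set Y := block_cost K (B ^ d) d.
have B0 : (0 < B)%N by lia.
have Y0 : (0 < Y)%N by rewrite !muln_gt0 fact_gt0 !expn_gt0 B0.
have [Y' Y'E] : exists Y', Y' = (32 * Y)%N by exists (32 * Y)%N.
have Y'0 : (0 < Y')%N by rewrite Y'E muln_gt0 Y0.
exists (4 * Y' * B)%:R^-1, (16 * Y%:R)^-1; split.
- by rewrite invr_gt0 ltr0n !muln_gt0 Y'0.
- by rewrite invr_gt0 mulr_gt0// ltr0n.
exists (2 * K + Y').+2 => // n /= hn a b _ hab.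
have nK : (2 * K <= n)%N by lia.
have nY : (Y' <= n)%N by lia.
have n2 : (2 <= n)%N by lia.
have d0 : (0 < d)%N by lia.
have [q [q0 nq qn]] := block_scale d0 n2.
have [t [t0 tn nt]] := sqrt_scale Y'0 nY.
apply: (@tour_interval_probability R d g H r B q n t) => //.
- by have -> : (2 * Y * (16 * t ^ 2) = Y' * t ^ 2)%N by rewrite Y'E; ring.
apply: le_lt_trans hab _.
have s := powR_scale R hd (ltnW n2) qn.
have rt : Num.sqrt n%:R < (2 * Y' * t)%:R :> R.
  by rewrite -(ltr_pXn2r (n := 2))// ?nnegrE// sqr_sqrtr// -natrX ltr_nat.
rewrite ltr_pdivlMr ?ltr0n ?muln_gt0 ?q0//.
rewrite [(q * B)%:R]natrM -!mulrA mulrC ltr_pdivrMr ?ltr0n ?muln_gt0 ?Y'0//.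
rewrite !natrM in rt *.
apply: (@le_lt_trans _ _ (2 * Num.sqrt n%:R * B%:R)).
  by rewrite mulrA ler_wpM2r.
rewrite [ltRHS](_ : _ = 2 * (2 * Y'%:R * t%:R) * B%:R); last by ring.
by rewrite ltr_pM2r ?ltr0n// ltr_pM2l.
Qed.
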